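(* Let $\alpha,\beta>0$, and let $(\mathcal{B},\mathcal{B}^* )$ be a two-dimensional exponentially alternating Brownian motion with parameters $\alpha,\beta$. Then the correlation coefficient function of $\mathcal{B}$ and $\mathcal{B}^*$, $$\mathrm{Corr}(t)=\frac{\mathbb{E}[B(t)B^*(t)]-\mathbb{E}[B(t)]\,\mathbb{E}[B^*(t)]}{\sqrt{\mathrm{Var}(B(t))}\sqrt{\mathrm{Var}(B^*(t))}}=\frac{\mathbb{E}[B(t)B^*(t)]}{t},\qquad t>0,$$ is given by $$\mathrm{Corr}(t)=\frac{\alpha^{-1}-\beta^{-1}}{\alpha^{-1}+\beta^{-1}}+\frac{2\alpha\left(1-e^{-t(\alpha+\beta)}\right)}{t(\alpha+\beta)^2},\qquad t>0.$$
   Context: Two-dimensional exponentially alternating Brownian motion: let $\mathcal{X}=\{X(t)\}_{t\ge0}$ be a Markov jump process with state space $\{0,1\}$, initial distribution $(1,0)$ (so $X(0)=0$) and intensity matrix $\begin{pmatrix}-\alpha&\alpha\\ \beta&-\beta\end{pmatrix}$, and let $\mathcal{B}=\{B(t)\}_{t\ge0}$ be a standard Brownian motion independent of $\mathcal{X}$. Define $\mathcal{B}^*=\{B^*(t)\}_{t\ge0}$ by $B^*(t)=\int_0^t(-1)^{X(s)}\,\mathrm{d}B(s)$, $t\ge0$. The process $(\mathcal{B},\mathcal{B}^* )$ is called a two-dimensional exponentially alternating Brownian motion. *)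

(* Defs.v *)
From HB Require Import structures.
From mathcomp Require Import all_boot all_order all_algebra.
From mathcomp Require Import all_classical all_reals all_analysis.

Set Implicit Arguments.
Unset Strict Implicit.
Unset Printing Implicit Defensive.

Import Order.TTheory GRing.Theory Num.Theory.
Import numFieldNormedType.Exports.

Local Open Scope classical_set_scope.
Local Open Scope ring_scope.

(* Continuous-time processes are families indexed by all of R, but every
   definition below only constrains their values at nonnegative times. *)

(* sigma-algebra generated by the variables Y s, s in I, when the state space
   of Y carries the sigma-algebra S. *)
Definition process_sigma {R : realType} {T U : Type} (S : set (set U))
    (Y : R -> T -> U) (I : set R) : set (set T) :=
  <<s \bigcup_(s in I) preimage_set_system setT (Y s) S >>.

(* Finite-state transition function: stochastic semigroup whose right
   derivative at 0 is the intensity matrix Q. *)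
Record transition_function {R : realType} (k : nat) (Q : 'M[R]_k)
    (p : R -> 'M[R]_k) : Prop := {
  transition_ge0 : forall (t : R) i j, 0 <= t -> 0 <= p t i j;
  transition_sum1 : forall (t : R) i, 0 <= t -> \sum_j p t i j = 1;
  transition_0 : p 0 = 1%:M;
  transition_semigroup : forall s t : R, 0 <= s -> 0 <= t ->
    p (s + t) = p s *m p t;
  transition_intensity : forall i j,
    h^-1 * (p h i j - p 0 i j) @[h --> 0^'+] --> Q i j }.

(* The Markov property is the elementary one,
     P(X_t = j | X_(s 0) = i 0, ..., X_(s n) = i n) = p_(t - s n)(i n, j),
   multiplied out so that conditioning events of probability 0 are allowed.
   Sample paths are right-continuous step functions with finitely many jumps
   in every bounded interval, i.e. cadlag for the discrete topology. *)
Record markov_jump_process {d} {T : measurableType d} {R : realType}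
    (P : probability T R) (k : nat) (mu : 'rV[R]_k) (Q : 'M[R]_k)
    (X : R -> T -> 'I_k) : Prop := {
  mjp_measurable : forall (t : R) j, 0 <= t -> measurable [set w | X t w = j];
  mjp_right_continuous : forall w (t : R), 0 <= t ->
    \forall s \near t^'+, X s w = X t w;
  mjp_left_limit : forall w (t : R), 0 < t ->
    exists j, \forall s \near t^'-, X s w = j;
  mjp_initial : forall j, P [set w | X 0 w = j] = (mu ord0 j)%:E;
  mjp_markov : exists2 p, transition_function Q p &
    forall (n : nat) (s : nat -> R) (i : nat -> 'I_k) (t : R) (j : 'I_k),
      0 <= s 0%N -> (forall m, (m < n)%N -> s m <= s m.+1) -> s n <= t ->
      let past := \bigcap_(m in `I_n.+1) [set w | X (s m) w = i m] in
      P (past `&` [set w | X t w = j]) =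
        (P past * (p (t - s n) (i n) j)%:E)%E }.

(* normal_prob m sigma takes the standard deviation as second argument. *)
Record standard_brownian_motion {d} {T : measurableType d} {R : realType}
    (P : probability T R) (B : R -> {RV P >-> R}) : Prop := {
  bm_0 : {ae P, forall w, B 0 w = 0};
  bm_continuous : {ae P, forall w,
    {within `[0, +oo[, continuous (fun t : R => B t w)}};
  bm_normal : forall s t : R, 0 <= s -> s < t -> forall A : set R, measurable A ->
    P [set w | A (B t w - B s w)] = normal_prob 0 (Num.sqrt (t - s)) A;
  bm_independent : forall (n : nat) (s : nat -> R) (A : nat -> set R),
    0 <= s 0%N -> (forall m, (m < n)%N -> s m <= s m.+1) ->
    (forall m, measurable (A m)) ->
    P (\bigcap_(m in `I_n) [set w | A m (B (s m.+1) w - B (s m) w)]) =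
      (\prod_(m < n) P [set w | A m (B (s m.+1) w - B (s m) w)%R])%E }.

(* Simple process on [0, t], adapted to F: bounded F (sp_time m)-measurable values
   sp_val m held on the intervals ]sp_time m, sp_time m.+1]. *)
Record simple_process {R : realType} {T : Type} (F : R -> set (set T))
    (t : R) := SimpleProcess {
  sp_size : nat;
  sp_time : nat -> R;
  sp_val : nat -> T -> R;
  sp_time0 : sp_time 0%N = 0;
  sp_timeN : sp_time sp_size = t;
  sp_time_le : forall m, (m < sp_size)%N -> sp_time m <= sp_time m.+1;
  sp_bounded : exists M : R, forall m w, (m < sp_size)%N -> `|sp_val m w| <= M;
  sp_adapted : forall m (A : set R), (m < sp_size)%N -> measurable A ->
    F (sp_time m) (sp_val m @^-1` A) }.

Definition simple_process_eval {R : realType} {T : Type}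
    (F : R -> set (set T)) (t : R) (S : simple_process F t)
    (s : R) (w : T) : R :=
  \sum_(m < sp_size S)
    sp_val S m w * \1_(`]sp_time S m, sp_time S m.+1]%classic) s.

Definition simple_ito {R : realType} {T : Type} (F : R -> set (set T))
    (t : R) (S : simple_process F t) (B : R -> T -> R) (w : T) : R :=
  \sum_(m < sp_size S)
    sp_val S m w * (B (sp_time S m.+1) w - B (sp_time S m) w).

(* I is (a version of) the Ito integral of H with respect to B over [0, t]:
   the L^2(P) limit of the integrals of simple processes S n converging to H
   in L^2(P x ds).  By the Ito isometry, for B a Brownian motion relative to F,
   I does not depend, up to a null set, on the sequence S. *)
Definition is_ito_integral {d} {T : measurableType d} {R : realType}
    (P : probability T R) (F : R -> set (set T)) (B : R -> T -> R)
    (H : R -> T -> R) (t : R) (I : T -> R) : Prop :=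
  exists S : nat -> simple_process F t,
    ((\int[P]_w \int[lebesgue_measure]_(s in `[0%R, t])
        ((simple_process_eval (S n) s w - H s w) ^+ 2)%R%:E)%E
       @[n --> \oo] --> 0%E) /\
    ((\int[P]_w ((simple_ito (S n) B w - I w) ^+ 2)%R%:E)%E
       @[n --> \oo] --> 0%E).

Definition alternating_mu {R : realType} : 'rV[R]_2 :=
  \row_j (if j == 0 then 1 else 0).

Definition alternating_Q {R : realType} (alpha beta : R) : 'M[R]_2 :=
  \matrix_(i, j) if i == 0 then (if j == 0 then - alpha else alpha)
                 else (if j == 0 then beta else - beta).

(* (B, Bs) is a two-dimensional exponentially alternating Brownian motion
   driven by the jump process X.  Integration is relative to the natural
   filtration of (X, B), for which B is a Brownian motion by independence. *)
Record exp_alternating_bm {d} {T : measurableType d} {R : realType}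
    (P : probability T R) (alpha beta : R) (X : R -> T -> 'I_2)
    (B Bs : R -> {RV P >-> R}) : Prop := {
  eabm_jump : markov_jump_process P alternating_mu (alternating_Q alpha beta) X;
  eabm_brownian : standard_brownian_motion B;
  eabm_independent : forall E G : set T,
    process_sigma setT X `[0, +oo[ E ->
    process_sigma measurable (fun t => B t : T -> R) `[0, +oo[ G ->
    P (E `&` G) = (P E * P G)%E;
  eabm_integral : forall t : R, 0 <= t ->
    is_ito_integral P
      (fun u => <<s process_sigma setT X `[0, u] `|`
                    process_sigma measurable (fun t => B t : T -> R) `[0, u] >>)
      (fun s => B s) (fun s w => (-1) ^+ (X s w : nat)) t (Bs t) }.

Definition corr {d} {T : measurableType d} {R : realType}
    (P : probability T R) (X Y : T -> R) : R :=
  (fine ('E_P[X \* Y])%E - fine ('E_P[X])%E * fine ('E_P[Y])%E) /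
    (Num.sqrt (fine ('V_P[X])%E) * Num.sqrt (fine ('V_P[Y])%E)).

(* Main.v *)
Require Import Defs.
From HB Require Import structures.
From mathcomp Require Import all_boot all_order all_algebra.
From mathcomp Require Import all_classical all_reals all_analysis.
From mathcomp Require Import measurable_realfun ring lra.

(** Write sigma_s = (-1)^X(s), so that the alternating motion is the Ito integral
    of sigma with respect to B.  The Ito isometry turns its moments into
    integrals over T x [0, t]:
      E[B(t) B*(t)] = E[int_0^t 1 sigma_s ds],
      E[B*(t)^2] = E[int_0^t sigma_s^2 ds] = t,    E[B*(t)] = 0.
    Together with E[B(t)] = 0 and E[B(t)^2] = t this reduces the correlation to
    the mean over [0, t] of E[sigma_s] = P(X(s) = 0) - P(X(s) = 1), which for the
    two-state chain started at 0 is
      (beta - alpha) / (alpha + beta)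
        + 2 alpha / (alpha + beta) exp (- (alpha + beta) s).

    The isometry itself is used for simple integrands.  The definition of the
    integral provides simple processes S_n that converge to sigma in
    L^2(T x [0, t]) and whose integrals I_n converge to B*(t) in L^2(T).  For
    them [ito_isometry] identifies the inner products of I_n with 1, B(t) and
    I_n, and [cvg_Rintegral_Lfun2M], the continuity of the inner product of L^2,
    passes to the limit on both sides.

    The isometry is proved by induction on the steps of the grid
    ([ito_step]): it rests on the moments of a Brownian increment, which come
    from those of the normal density, and on its independence of the past of the
    pair (X, B) ([indep_joint_filtration]).  That independence is a succession of
    pi-lambda arguments: from rectangles of increments, to the values of B at
    finitely many times, to the past of B, to the joint past.

    To treat sigma as an element of L^2(T x [0, t]) and exchange the two
    integrals one needs its joint measurability, which follows from the
    right-continuity of the paths ([measurable_right_continuous_process]).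

    For the law of X(s), the intensity matrix gives only right derivatives at 0.
    The second eigenvalue g of the transition matrices is multiplicative, and
    g(s) = g(s / n)^n identifies it with exp (- (alpha + beta) s)
    ([two_state_eigenvalue]); the transition probabilities are affine functions
    of g. *)

Set Implicit Arguments.
Unset Strict Implicit.
Unset Printing Implicit Defensive.

Import Order.TTheory GRing.Theory Num.Theory.
Import numFieldNormedType.Exports.

Local Open Scope classical_set_scope.
Local Open Scope ring_scope.

(** * Square-integrable functions *)

Lemma integrable_sqr_Lfun2 d (T : measurableType d) (R : realType)
    (mu : {measure set T -> \bar R}) (f : T -> R) :
  measurable_fun setT f -> (\int[mu]_x (f x ^+ 2)%:E < +oo)%E ->
  f \in Lfun mu 2%:E.
Proof.
move=> mf f2; rewrite inE; apply/andP; split; rewrite inE//=.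
rewrite /finite_norm unlock /Lnorm/= poweR_lty//.
under eq_integral => x _ do rewrite powR_mulrn// real_normK ?num_real//.
exact: f2.
Qed.

Section Lfun2_inner_product.
Context d (T : measurableType d) (R : realType).
Variable mu : {measure set T -> \bar R}.
Implicit Types f g : T -> R.

Lemma Lfun2Z k f : f \in Lfun mu 2%:E -> (fun x => k * f x) \in Lfun mu 2%:E.
Proof.
move=> Lf; rewrite (_ : (fun x => _) = k \o* f).
  by apply: Lfun_scale; rewrite ?ler1n.
by apply/funext => x /=; rewrite mulrC.
Qed.

Lemma Lfun2D f g : f \in Lfun mu 2%:E -> g \in Lfun mu 2%:E ->
  (fun x => f x + g x) \in Lfun mu 2%:E.
Proof. by move=> Lf Lg; apply: rpredD => //; rewrite lee1n. Qed.

Lemma Lfun2B f g : f \in Lfun mu 2%:E -> g \in Lfun mu 2%:E ->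
  (fun x => f x - g x) \in Lfun mu 2%:E.
Proof. by move=> Lf Lg; apply: rpredB => //; rewrite lee1n. Qed.

Lemma integrable_Lfun2M f g : f \in Lfun mu 2%:E -> g \in Lfun mu 2%:E ->
  mu.-integrable setT (EFin \o (fun x => f x * g x)).
Proof. by move=> f2 g2; apply/Lfun1_integrable; exact: Lfun2_mul_Lfun1. Qed.

Lemma Rintegral_Lfun2DM f1 f2 g : f1 \in Lfun mu 2%:E -> f2 \in Lfun mu 2%:E ->
  g \in Lfun mu 2%:E ->
  \int[mu]_x ((f1 x + f2 x) * g x) =
  \int[mu]_x (f1 x * g x) + \int[mu]_x (f2 x * g x).
Proof.
move=> Lf1 Lf2 Lg; rewrite -RintegralD//; try exact: integrable_Lfun2M.
by apply: eq_Rintegral => x _; rewrite mulrDl.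
Qed.

Lemma Rintegral_Lfun2MC f g : \int[mu]_x (f x * g x) = \int[mu]_x (g x * f x).
Proof. by apply: eq_Rintegral => x _; rewrite mulrC. Qed.

Lemma Rintegral_Lfun2MD f1 f2 g : f1 \in Lfun mu 2%:E -> f2 \in Lfun mu 2%:E ->
  g \in Lfun mu 2%:E ->
  \int[mu]_x (g x * (f1 x + f2 x)) =
  \int[mu]_x (g x * f1 x) + \int[mu]_x (g x * f2 x).
Proof.
move=> Lf1 Lf2 Lg; rewrite ![\int[mu]__ (g _ * _)]Rintegral_Lfun2MC.
exact: Rintegral_Lfun2DM.
Qed.

Lemma Rintegral_Lfun2ZM k f g : f \in Lfun mu 2%:E -> g \in Lfun mu 2%:E ->
  \int[mu]_x ((k * f x) * g x) = k * \int[mu]_x (f x * g x).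
Proof.
move=> Lf Lg; rewrite -RintegralZl//; last exact: integrable_Lfun2M.
by apply: eq_Rintegral => x _; rewrite mulrA.
Qed.

(** The quadratic form in the reals t that sends t to the integral of
    (t f + g)^2 is nonnegative, so its discriminant is nonpositive. *)
Lemma Rintegral_cauchy_schwarz f g : f \in Lfun mu 2%:E -> g \in Lfun mu 2%:E ->
  `|\int[mu]_x (f x * g x)| <=
  Num.sqrt (\int[mu]_x (f x * f x)) * Num.sqrt (\int[mu]_x (g x * g x)).
Proof.
move=> Lf Lg.
set B := \int[mu]_x (f x * g x); set A := \int[mu]_x (f x * f x).
set C := \int[mu]_x (g x * g x).
have A0 : 0 <= A by apply: Rintegral_ge0 => x _; rewrite -expr2 sqr_ge0.
have C0 : 0 <= C by apply: Rintegral_ge0 => x _; rewrite -expr2 sqr_ge0.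
have quad t : 0 <= t ^+ 2 * A + 2 * t * B + C.
  have : 0 <= \int[mu]_x ((t * f x + g x) * (t * f x + g x)).
    by apply: Rintegral_ge0 => x _; rewrite -expr2 sqr_ge0.
  have Ltf : (fun x => t * f x) \in Lfun mu 2%:E.
    exact: Lfun2Z.
  have Ls : (fun x => t * f x + g x) \in Lfun mu 2%:E by exact: Lfun2D.
  rewrite Rintegral_Lfun2DM// !Rintegral_Lfun2MD//.
  rewrite !(Rintegral_Lfun2MC _ (fun x => t * f x)) !Rintegral_Lfun2ZM//.
  rewrite !(Rintegral_Lfun2MC _ (fun x => t * f x)) !Rintegral_Lfun2ZM//.
  by rewrite -/A -/B -/C; lra.
rewrite -sqrtrM// -sqrtr_sqr ler_wsqrtr//.
have [A_eq0|A_neq0] := eqVneq A 0.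
  have [->|B_neq0] := eqVneq B 0; first by rewrite expr0n/= A_eq0 mul0r.
  (* For A = 0 the form is affine in t with slope 2 B; this t sends it to -1. *)
  have := quad (- (C + 1) / (2 * B)); rewrite A_eq0 mulr0 add0r.
  rewrite (_ : 2 * (- (C + 1) / (2 * B)) * B = - (C + 1));
    last by field; rewrite B_neq0.
  by lra.
have {}A0 : 0 < A by rewrite lt_def A_neq0.
(* The minimum of the form is reached at - B / A. *)
have := quad (- B / A).
rewrite (_ : _ + _ + _ = (A * C - B ^+ 2) / A); last by field; rewrite A_neq0.
by rewrite pmulr_lge0 ?invr_gt0// subr_ge0.
Qed.

Section continuity.
Variables (f_ g_ : nat -> T -> R) (f g : T -> R).
Hypotheses (Lf_ : forall n, f_ n \in Lfun mu 2%:E)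
  (Lg_ : forall n, g_ n \in Lfun mu 2%:E).
Hypotheses (Lf : f \in Lfun mu 2%:E) (Lg : g \in Lfun mu 2%:E).
Hypothesis cvf : (\int[mu]_x ((f_ n x - f x) ^+ 2)%:E)%E @[n --> \oo] --> 0%E.
Hypothesis cvg : (\int[mu]_x ((g_ n x - g x) ^+ 2)%:E)%E @[n --> \oo] --> 0%E.

(** Continuity of the inner product of L^2.  Convergence is expressed by the
    squared distances, which is the form in which the convergence of simple
    processes and of their integrals is given in the definition of the Ito
    integral.  The proof bounds the difference by Cauchy-Schwarz after writing
    f_n = (f_n - f) + f and g_n = (g_n - g) + g. *)
Lemma cvg_Rintegral_Lfun2M :
  \int[mu]_x (f_ n x * g_ n x) @[n --> \oo] --> \int[mu]_x (f x * g x).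
Proof.
pose df n x := f_ n x - f x; pose dg n x := g_ n x - g x.
have Ldf n : df n \in Lfun mu 2%:E by exact: Lfun2B.
have Ldg n : dg n \in Lfun mu 2%:E by exact: Lfun2B.
have cdf : \int[mu]_x (df n x * df n x) @[n --> \oo] --> 0.
  exact: fine_cvg cvf.
have cdg : \int[mu]_x (dg n x * dg n x) @[n --> \oo] --> 0.
  exact: fine_cvg cvg.
have csq (u : nat -> R) : u n @[n --> \oo] --> 0 ->
    Num.sqrt (u n) @[n --> \oo] --> 0.
  by move=> u0; rewrite -sqrtr0; apply: continuous_cvg => //; exact: sqrt_continuous.
apply/subr_cvg0.
pose b n := Num.sqrt (\int[mu]_x (df n x * df n x)) *
    Num.sqrt (\int[mu]_x (dg n x * dg n x))
  + Num.sqrt (\int[mu]_x (f x * f x)) * Num.sqrt (\int[mu]_x (dg n x * dg n x))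
  + Num.sqrt (\int[mu]_x (df n x * df n x)) * Num.sqrt (\int[mu]_x (g x * g x)).
have b0 : b n @[n --> \oo] --> 0.
  rewrite -[X in _ --> X](_ : 0 * 0 + Num.sqrt (\int[mu]_x (f x * f x)) * 0
    + 0 * Num.sqrt (\int[mu]_x (g x * g x)) = 0);
    last by rewrite !(mul0r, mulr0) !addr0.
  apply: cvgD; first apply: cvgD.
  - by apply: cvgM; exact: csq.
  - by apply: cvgM; [exact: cvg_cst|exact: csq].
  - by apply: cvgM; [exact: csq|exact: cvg_cst].
apply: norm_cvg0; apply: (squeeze_cvgr _ (cvg_cst 0) b0).
apply: nearW => n; rewrite normr_ge0 /b/=.
have -> : \int[mu]_x (f_ n x * g_ n x) =
    \int[mu]_x ((df n x + f x) * (dg n x + g x)).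
  by apply: eq_Rintegral => x _; rewrite /df /dg !subrK.
move: (df n) (dg n) (Ldf n) (Ldg n) => u v Lu Lv.
have Lsg : (fun x => v x + g x) \in Lfun mu 2%:E by exact: Lfun2D.
rewrite Rintegral_Lfun2DM// !Rintegral_Lfun2MD// addrA addrK addrAC.
apply: le_trans (ler_normD _ _) _; apply: lerD; last exact: Rintegral_cauchy_schwarz.
by apply: le_trans (ler_normD _ _) _; apply: lerD; exact: Rintegral_cauchy_schwarz.
Qed.

End continuity.
End Lfun2_inner_product.

(** * Moments of the centred normal law *)

(** The Radon-Nikodym derivative of the normal law with respect to the Lebesgue
    measure agrees almost everywhere with the density, since both have the same
    integral over every measurable set. *)
Lemma ge0_integral_normal_prob (R : realType) (m s : R)
    (f : measurableTypeR R -> \bar R) :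
  measurable_fun setT f -> (forall x, (0 <= f x)%E) ->
  (\int[normal_prob m s]_x f x =
   \int[lebesgue_measure]_x (f x * (normal_pdf m s x)%:E))%E.
Proof.
move=> mf f0; have dom := normal_prob_dominates m s.
rewrite -(Radon_Nikodym_SigmaFinite.change_of_variables dom f0)//.
apply: ae_eq_integral => //.
- apply: emeasurable_funM => //.
  exact: measurable_int (Radon_Nikodym_SigmaFinite.f_integrable dom).
- apply: emeasurable_funM => //; apply/measurable_EFinP.
  exact: measurable_normal_pdf.
- apply: ae_eqe_mul2l; apply: integral_ae_eq => //.
  + exact: Radon_Nikodym_SigmaFinite.f_integrable dom.
  + by apply/measurable_EFinP; exact: measurable_normal_pdf.
  + by move=> E _ mE; rewrite -(Radon_Nikodym_SigmaFinite.f_integral dom).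
Qed.

Lemma normal_pdf0E (R : realType) (s x : R) : s != 0 ->
  normal_pdf 0 s x = normal_peak s * expR (- x ^+ 2 / (s ^+ 2 *+ 2)).
Proof. by move=> s0; rewrite normal_pdfE// /normal_fun subr0. Qed.

Lemma is_derive_normal_pdf (R : realType) (s x : R) : s != 0 ->
  is_derive x 1 (normal_pdf 0 s) (- (x / s ^+ 2) * normal_pdf 0 s x).
Proof.
move=> s0.
rewrite (_ : normal_pdf 0 s = fun x =>
    normal_peak s * expR (- x ^+ 2 / (s ^+ 2 *+ 2))); last first.
  by apply/funext => y; rewrite normal_pdf0E.
apply: is_derive_eq.
rewrite /GRing.scale/= !mulr1 -mulr_natr; field.
by rewrite s0.
Qed.

Lemma normal_pdf0_even (R : realType) (s x : R) : s != 0 ->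
  normal_pdf 0 s (- x) = normal_pdf 0 s x.
Proof. by move=> s0; rewrite !normal_pdf0E// sqrrN. Qed.

(** Integration by parts: by the equation phi' = - (x / s^2) phi of the density
    phi, the function (x^2 - s^2) phi is the derivative of - s^2 x phi. *)
Lemma integral_normal_sqr_itv (R : realType) (s : R) (n : nat) : s != 0 ->
  (\int[lebesgue_measure]_(x in `[0%R, n%:R]) (x ^+ 2 * normal_pdf 0 s x)%:E =
   (s ^+ 2)%:E * \int[lebesgue_measure]_(x in `[0%R, n%:R]) (normal_pdf 0 s x)%:E
   - (s ^+ 2 * (n%:R * normal_pdf 0 s n%:R))%:E)%E.
Proof.
move=> s0.
have cphi : continuous (normal_pdf 0 s) by exact: continuous_normal_pdf.
have cx2 : continuous (fun x : R => x ^+ 2 * normal_pdf 0 s x).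
  by move=> x; apply: cvgM; [exact: exprn_continuous|exact: cphi].
have iphi : lebesgue_measure.-integrable `[0%R, n%:R]
    (fun x => (normal_pdf 0 s x)%:E).
  by apply: (integrableS measurableT) => //; exact: integrable_normal_pdf.
have [->|n0] := posnP n.
  by rewrite set_itv1 !integral_set1 mule0 mul0r mulr0 sube0.
pose F x := - (s ^+ 2 * (x * normal_pdf 0 s x)).
have dF (x : R) :
    is_derive x 1 F (x ^+ 2 * normal_pdf 0 s x - s ^+ 2 * normal_pdf 0 s x).
  rewrite /F; have := @is_derive_normal_pdf R s x s0 => dphi.
  apply: is_derive_eq; rewrite /GRing.scale/=; field.
  by rewrite s0.
have cf : {within `[0, n%:R],
  continuous (fun x : R => x ^+ 2 * normal_pdf 0 s x - s ^+ 2 * normal_pdf 0 s x)}.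
  apply: continuous_subspaceT => x.
  by apply: (@cvgB _ R^o); [exact: cx2|apply: cvgM; [exact: cvg_cst|exact: cphi]].
have cF (x : R) : F x @[x --> x] --> F x.
  by apply: differentiable_continuous; apply/derivable1_diffP; case: (dF x).
have FTC : (\int[lebesgue_measure]_(x in `[0%R, n%:R])
    (x ^+ 2 * normal_pdf 0 s x - s ^+ 2 * normal_pdf 0 s x)%:E =
    (F n%:R)%:E - (F 0)%:E)%E.
  apply: (continuous_FTC2 _ cf); rewrite ?ltr0n//.
  - split; first by move=> x _; case: (dF x).
    + exact: cvg_at_right_filter.
    + exact: cvg_at_left_filter.
  - by move=> x _; rewrite derive1E; have [_ ->] := dF x.
have compact_int f : continuous f ->
    lebesgue_measure.-integrable `[0%R, n%:R] (EFin \o (f : R -> R)).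
  move=> fc; apply: continuous_compact_integrable; first exact: segment_compact.
  exact: continuous_subspaceT.
under eq_integral => x _.
  rewrite -(subrK (s ^+ 2 * normal_pdf 0 s x) (_ * _)) EFinD; over.
rewrite integralD_EFin//.
- rewrite FTC /F mul0r mulr0 oppr0 sube0 addeC -integralZl// EFinN.
- apply: compact_int => x; apply: (@cvgB _ R^o); first exact: cx2.
  by apply: cvgM; [exact: cvg_cst|exact: cphi].
- exact: (integrableZl _ _ iphi).
Qed.

(** The inequality y <= exp y at y = x^2 / (2 s^2) bounds x phi(x) by a multiple
    of 1 / x. *)
Lemma cvg_mul_normal_pdf (R : realType) (s : R) : s != 0 ->
  n%:R * normal_pdf 0 s n%:R @[n --> \oo] --> (0 : R).
Proof.
move=> s0.
pose K : R := 2 * s ^+ 2 * normal_peak s.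
have s2 : 0 < s ^+ 2 by rewrite exprn_even_gt0.
apply: (@squeeze_cvgr _ _ _ _ (fun=> 0) (fun n : nat => K * n%:R^-1)).
- near=> n; have n0 : (0 < n%:R :> R).
    by rewrite ltr0n; near: n; exact: nbhs_infty_gt.
  rewrite mulr_ge0 ?normal_pdf_ge0//=.
  rewrite normal_pdf0E// /K mulrCA -mulrA [leRHS]mulrC -!mulrA.
  rewrite [leRHS]mulrC.
  rewrite mulNr expRN.
  rewrite [leRHS]mulrC -!mulrA ler_wpM2l ?normal_peak_ge0//.
  have E : n%:R ^+ 2 / (s ^+ 2 *+ 2) <= expR (n%:R ^+ 2 / (s ^+ 2 *+ 2)).
    by apply: le_trans (expR_ge1Dx _); lra.
  rewrite ler_pdivrMr ?expR_gt0//.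
  apply: (@le_trans _ _ (n%:R^-1 * (2 * s ^+ 2) * (n%:R ^+ 2 / (s ^+ 2 *+ 2)))).
    rewrite -mulr_natr le_eqVlt; apply/orP; left; apply/eqP; field.
    by rewrite s0 gt_eqF.
  rewrite [n%:R * (_ / _)]mulrA -expr2 ler_wpM2l// mulr_ge0 ?invr_ge0//; lra.
- exact: cvg_cst.
- rewrite -[X in _ --> X](mulr0 K); apply: cvgM; first exact: cvg_cst.
  apply/(@gtr0_cvgV0 R nat \oo _ (fun n => n%:R)); first last.
    exact: cvgr_idn.
  by near=> n; rewrite ltr0n; near: n; exact: nbhs_infty_gt.
Unshelve. all: by end_near. Qed.

Lemma integral_normal_sqr (R : realType) (s : R) : s != 0 ->
  (\int[lebesgue_measure]_x (x ^+ 2 * normal_pdf 0 s x)%:E = (s ^+ 2)%:E)%E.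
Proof.
move=> s0.
have cphi : continuous (normal_pdf 0 s) by exact: continuous_normal_pdf.
have cx2 : continuous (fun x : R => x ^+ 2 * normal_pdf 0 s x).
  by move=> x; apply: cvgM; [exact: exprn_continuous|exact: cphi].
have x2_ge0 (x : R) : 0 <= x ^+ 2 * normal_pdf 0 s x.
  by rewrite mulr_ge0 ?sqr_ge0 ?normal_pdf_ge0.
have half : (\int[lebesgue_measure]_(x in `[0%R, +oo[)
      (x ^+ 2 * normal_pdf 0 s x)%:E =
    (s ^+ 2)%:E * \int[lebesgue_measure]_(x in `[0%R, +oo[) (normal_pdf 0 s x)%:E)%E.
  have mx2 : measurable_fun setT (fun x : R => x ^+ 2 * normal_pdf 0 s x).
    exact: continuous_measurable_fun.
  have c1 := @ge0_cvgn_integral R lebesgue_measure _ x2_ge0 mx2.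
  have c2 := @ge0_cvgn_integral R lebesgue_measure _ (normal_pdf_ge0 0 s)
    (measurable_normal_pdf 0 s).
  move: c1; under eq_fun do rewrite integral_normal_sqr_itv//.
  move=> c1; apply: (cvg_unique _ c1) => //=.
  rewrite -[X in _ --> X]adde0; apply: cvgeD.
  - by rewrite fin_num_adde_defl.
  - exact: cvgeZl.
  - apply: cvg_EFin; first by near=> n.
    rewrite -[X in _ --> X]oppr0 -[X in _ --> - X](mulr0 (s ^+ 2)).
    apply: cvgN; apply: cvgM; first exact: cvg_cst.
    exact: cvg_mul_normal_pdf.
have := @integral_normal_pdf R 0 s.
rewrite !ge0_symfun_integralT//.
- rewrite -set_itvcy half => h.
  by rewrite muleCA h mule1.
- by move=> x /=; rewrite sqrrN normal_pdf0_even.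
- by move=> x; exact: normal_pdf_ge0.
- by move=> x /=; rewrite normal_pdf0_even.
Unshelve. all: by end_near. Qed.

Lemma ge0_integral_lebesgueN (R : realType) (g : R -> \bar R) :
  measurable_fun [set: R] g -> (forall x, (0 <= g x)%E) ->
  (\int[lebesgue_measure]_x g (- x)%R = \int[lebesgue_measure]_x g x)%E.
Proof.
move=> mg g0.
rewrite -[X in (\int[_]_(_ in X) _)%E = _]
  (preimage_setT (-%R : _ -> measurableTypeR R)).
rewrite -(@ge0_integral_pushforward _ _ (measurableTypeR R) (measurableTypeR R) R
  (-%R : measurableTypeR R -> measurableTypeR R))//.
by apply: eq_measure_integral => //= A mA _; exact: lebesgue_measureN.
Qed.

Section centered_normal.
Context d (T : measurableType d) (R : realType) (P : probability T R).
Variables (Y : T -> R) (s : R).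
Hypothesis mY : measurable_fun setT Y.
Hypothesis s0 : s != 0.
Hypothesis PY : forall A : set R, measurable A ->
  P (Y @^-1` A) = normal_prob 0 s A.

Lemma ge0_integral_normal (f : R -> \bar R) :
  measurable_fun [set: R] f -> (forall x, (0 <= f x)%E) ->
  (\int[P]_w f (Y w) = \int[lebesgue_measure]_x (f x * (normal_pdf 0 s x)%:E))%E.
Proof.
move=> mf f0; rewrite -ge0_integral_normal_prob//.
pose Y' : T -> measurableTypeR R := Y.
have mY' : measurable_fun setT Y' by [].
rewrite -[X in (\int[_]_(_ in X) _)%E = _](preimage_setT Y').
rewrite -(@ge0_integral_pushforward _ _ _ (measurableTypeR R) R Y' mY')//.
by apply: eq_measure_integral => //= A mA _; exact: PY.
Qed.

Lemma integral_sqr_normal : (\int[P]_w (Y w ^+ 2)%:E = (s ^+ 2)%:E)%E.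
Proof.
rewrite (ge0_integral_normal (f := fun x => (x ^+ 2)%:E)).
- exact: integral_normal_sqr.
- by apply/measurable_EFinP; exact: measurable_funX.
- by move=> x; rewrite lee_fin sqr_ge0.
Qed.

Lemma Lfun2_normal : Y \in Lfun P 2%:E.
Proof. by apply: integrable_sqr_Lfun2 => //; rewrite integral_sqr_normal ltry. Qed.

(** The density is even, so the positive and the negative parts of Y have the
    same integral; it is finite because Y is square-integrable. *)
Lemma integral_normal : (\int[P]_w (Y w)%:E = 0)%E.
Proof.
have iY : P.-integrable setT (EFin \o Y).
  apply/Lfun1_integrable; apply: Lfun_subset12 Lfun2_normal.
  exact: fin_num_measure.
pose pos (x : R) : \bar R := (Num.max x 0)%:E.
have mpos : measurable_fun [set: R] pos.
  by apply/measurable_EFinP; exact: measurable_maxr.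
have pos0 x : (0 <= pos x)%E by rewrite lee_fin le_max lexx orbT.
have negE : (EFin \o Y)^\-%E = fun w => pos (- Y w).
  by apply/funext => w; rewrite funenegE -EFin_max.
rewrite integralE (_ : (fun _ => _)^\+%E = fun w => pos (Y w)); last first.
  by apply/funext => w; rewrite funeposE -EFin_max.
have := integrable_neg_fin_num measurableT iY; rewrite negE.
rewrite (ge0_integral_normal mpos pos0).
rewrite (ge0_integral_normal (f := fun x => pos (- x))) => //; last first.
  exact: measurableT_comp.
have mpdf : measurable_fun [set: R] (fun x => (normal_pdf 0 s x)%:E).
  by apply/measurable_EFinP; exact: measurable_normal_pdf.
rewrite -(ge0_integral_lebesgueN (g := fun x => (pos x * (normal_pdf 0 s x)%:E)%E)).
- under [X in (X - _)%E = _]eq_integral do rewrite (normal_pdf0_even _ s0).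
  exact: subee.
- exact: emeasurable_funM.
- by move=> x; rewrite mule_ge0// lee_fin normal_pdf_ge0.
Qed.

End centered_normal.

(** * Tensor products and independent variables *)

Section tensor_product.
Context d1 d2 (T1 : measurableType d1) (T2 : measurableType d2) (R : realType).
Variables (m1 : {sigma_finite_measure set T1 -> \bar R})
  (m2 : {sigma_finite_measure set T2 -> \bar R}).
Variables (f : T1 -> R) (g : T2 -> R).
Hypotheses (f1 : f \in Lfun m1 1) (g1 : g \in Lfun m2 1).

Lemma Lfun1_tensor : (fun z => f z.1 * g z.2) \in Lfun (m1 \x m2)%E 1.
Proof.
move/Lfun1_integrable/integrableP : f1 => [/measurable_EFinP mf If].
move/Lfun1_integrable/integrableP : g1 => [/measurable_EFinP mg Ig].
have mfg : measurable_fun setT (EFin \o (fun z : T1 * T2 => f z.1 * g z.2)).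
  apply/measurable_EFinP; apply: measurable_funM.
    by apply: measurableT_comp.
  by apply: measurableT_comp.
apply/Lfun1_integrable/(integrable12ltyP _ _ mfg).
under eq_integral.
  move=> x _; under eq_integral do rewrite /= normrM EFinM.
  rewrite ge0_integralZl//; last exact/measurable_EFinP/measurableT_comp.
  over.
rewrite /= ge0_integralZr//; last 2 first.
- exact/measurable_EFinP/measurableT_comp.
- exact: integral_ge0.
apply: lte_mul_pinfty => //; first exact: integral_ge0.
by rewrite ge0_fin_numE//; exact: integral_ge0.
Qed.

Lemma Rintegral_tensor :
  \int[(m1 \x m2)%E]_z (f z.1 * g z.2) = \int[m1]_x f x * \int[m2]_y g y.
Proof.
have If := (Lfun1_integrable _ _).1 f1.
have Ig := (Lfun1_integrable _ _).1 g1.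
have fg : (\int[m2]_y (g y)%:E)%E \is a fin_num by exact: integrable_fin_num.
rewrite /Rintegral -fineM//; last exact: integrable_fin_num.
congr fine; rewrite -integral12_prod_meas1; last first.
  exact/Lfun1_integrable/Lfun1_tensor.
rewrite /fubini_F/=; under eq_integral.
  move=> x _; under eq_integral do rewrite EFinM.
  rewrite integralZl//; over.
by rewrite /= -(fineK fg) integralZr.
Qed.

End tensor_product.

(** For independent U and V the law of (U, V) is the product of the laws, so the
    mean of U V is the integral of a tensor product. *)
Section independent_product.
Context d (T : measurableType d) (R : realType) (P : probability T R).
Variables U V : T -> R.
Hypotheses (mU : measurable_fun setT U) (mV : measurable_fun setT V).
Hypothesis UV_indep : forall A B : set R, measurable A -> measurable B ->
  P (U @^-1` A `&` V @^-1` B) = (P (U @^-1` A) * P (V @^-1` B))%E.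
Hypotheses (U1 : U \in Lfun P 1) (V1 : V \in Lfun P 1).

Let U' : {RV P >-> R} := mfun_Sub (mem_set mU).
Let V' : {RV P >-> R} := mfun_Sub (mem_set mV).
Let W (w : T) : R * R := (U w, V w).

Let mW : measurable_fun setT W.
Proof. by apply: measurable_fun_pair. Qed.

Let W' : {RV P >-> (R * R)%type} := mfun_Sub (mem_set mW).

Let joint_law (A : set (R * R)) : measurable A ->
  (distribution P U' \x distribution P V')%E A = distribution P W' A.
Proof.
move=> mA; apply: (@product_measure_unique _ _ _ _ R (distribution P U')
  (distribution P V') (distribution P W')) => // B C mB mC; exact: UV_indep.
Qed.

Let Lfun1_law (Y : {RV P >-> R}) : (Y : T -> R) \in Lfun P 1 ->
  (fun x : R => x) \in Lfun (distribution P Y) 1.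
Proof.
move=> /Lfun1_integrable/integrableP[_ iY]; apply/Lfun1_integrable/integrableP.
split; first exact: EFin_measurable.
rewrite (@ge0_integral_distribution _ _ _ _ _ P Y (fun x => `|x%:E|%E))//.
exact: measurableT_comp.
Qed.

Let Rintegral_law (Y : {RV P >-> R}) : (Y : T -> R) \in Lfun P 1 ->
  \int[distribution P Y]_x x = \int[P]_w Y w.
Proof.
move=> /Lfun1_integrable iY.
by rewrite /Rintegral (integral_distribution (f := EFin)).
Qed.

Let mM : measurable_fun [set: R * R] (fun z : R * R => (z.1 * z.2)%:E).
Proof. by apply/measurable_EFinP; exact: measurable_funM. Qed.

Let Q := (distribution P U' \x distribution P V')%E.

Let Lfun1M : (fun z : R * R => z.1 * z.2) \in Lfun Q 1.
Proof. exact: (@Lfun1_tensor _ _ _ _ R (distribution P U') (distribution P V') id id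
  (@Lfun1_law U' U1) (@Lfun1_law V' V1)). Qed.

Lemma Lfun1_indepM : (fun w => U w * V w) \in Lfun P 1.
Proof.
have /Lfun1_integrable/integrableP[_ iM] := Lfun1M.
apply/Lfun1_integrable/integrableP; split.
  by apply/measurable_EFinP; exact: measurable_funM.
apply: le_lt_trans iM; rewrite le_eqVlt; apply/orP; left; apply/eqP.
transitivity (\int[distribution P W']_z `|(z.1 * z.2)%:E|)%E.
  by rewrite ge0_integral_distribution//; exact: measurableT_comp.
by apply: eq_measure_integral => /= A mA _; exact/esym/joint_law.
Qed.

Lemma Rintegral_indepM :
  \int[P]_w (U w * V w) = (\int[P]_w U w) * (\int[P]_w V w).
Proof.
rewrite -(Rintegral_law (Y := U') U1) -(Rintegral_law (Y := V') V1).
rewrite -(@Rintegral_tensor _ _ _ _ R (distribution P U') (distribution P V') id id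
  (@Lfun1_law U' U1) (@Lfun1_law V' V1)); congr fine.
transitivity (\int[distribution P W']_z (z.1 * z.2)%:E)%E.
  rewrite integral_distribution//; exact/Lfun1_integrable/Lfun1_indepM.
by apply: eq_measure_integral => /= A mA _; exact/esym/joint_law.
Qed.

End independent_product.

(** * Independence of Brownian increments from the past *)

Section pi_system_independence.
Context d (T : measurableType d) (R : realType) (P : probability T R).
Implicit Types (G : set (set T)) (D E : set T).

Definition indep_set G D := forall E, G E -> P (E `&` D) = (P E * P D)%E.

(** The two finite measures that send E to P (E & D) and to P E * P D agree on
    the pi-system G, hence on the sigma-algebra that it generates. *)
Lemma indep_set_sigma G D : measurable D -> G `<=` measurable ->
  setI_closed G -> indep_set G D -> indep_set <<s G >> D.
Proof.
move=> mD mG GI indG E sE.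
have PD : P D = (fine (P D))%:E by rewrite fineK// fin_num_measure.
pose m1 : {measure set T -> \bar R} := mrestr P mD.
pose r : {nonneg R} := NngNum (fine_ge0 (measure_ge0 P D)).
pose m2 : {measure set T -> \bar R} := mscale r P.
have GE : [set X | G X /\ X `<=` setT] = G.
  by apply/seteqP; split=> [X []//|X GX]; split.
rewrite (_ : P (E `&` D) = m1 E)// (_ : (P E * P D)%E = m2 E); last first.
  by rewrite muleC PD.
apply: (@g_sigma_algebra_measure_unique_trace _ R T G setT); rewrite ?GE//.
- rewrite /m1 /m2 /= /mrestr /mscale/= setTI probability_setT mule1.
  exact: PD.
- by move=> A GA; rewrite /m1 /m2/= /mrestr /mscale/= indG// muleC {1}PD.
- rewrite /m1/= /mrestr setTI; apply: le_lt_trans (probability_le1 _ mD) _.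
  exact: ltry.
Qed.

Lemma measure_setI_full E D : measurable E -> measurable D -> P D = 1%E ->
  P (E `&` D) = P E.
Proof.
move=> mE mD PD.
have PDC : P (~` D) = 0%E by rewrite probability_setC// PD subee.
rewrite [RHS](measureDI P mE mD) [X in (X + _)%E](_ : _ = 0%E) ?add0e//.
apply: (subset_measure0 (B := ~` D)) PDC => //.
- exact: measurableD.
- exact: measurableC.
Qed.

End pi_system_independence.

(** Measurability with respect to a sigma-algebra other than the one that the
    type T carries: this is the form of adaptedness used by simple processes. *)
Definition sigma_measurable {T : Type} {R : realType} (G : set (set T))
  (f : T -> R) := forall A : set R, measurable A -> <<s G >> (f @^-1` A).

Section sigma_measurable.
Context d (T : measurableType d) (R : realType) (G : set (set T)).
Implicit Types f g : T -> R.

Lemma sigma_measurableP f :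
  sigma_measurable G f <-> measurable_fun setT (f : g_sigma_algebraType G -> R).
Proof.
split=> [Gf _ A mA|Gf A mA]; first by rewrite setTI; exact: Gf.
by have := Gf measurableT A mA; rewrite setTI.
Qed.

Lemma sigma_measurable_cst c : sigma_measurable G (fun=> c : R).
Proof. by apply/sigma_measurableP; exact: measurable_cst. Qed.

Lemma sigma_measurableM f g : sigma_measurable G f -> sigma_measurable G g ->
  sigma_measurable G (fun w => f w * g w).
Proof.
by move=> /sigma_measurableP Gf /sigma_measurableP Gg; apply/sigma_measurableP;
  exact: measurable_funM.
Qed.

Lemma sigma_measurableD f g : sigma_measurable G f -> sigma_measurable G g ->
  sigma_measurable G (fun w => f w + g w).
Proof.
by move=> /sigma_measurableP Gf /sigma_measurableP Gg; apply/sigma_measurableP;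
  exact: measurable_funD.
Qed.

Lemma sigma_measurableB f g : sigma_measurable G f -> sigma_measurable G g ->
  sigma_measurable G (fun w => f w - g w).
Proof.
by move=> /sigma_measurableP Gf /sigma_measurableP Gg; apply/sigma_measurableP;
  exact: measurable_funB.
Qed.

Lemma sigma_measurable_sum n (f : nat -> T -> R) :
  (forall m, (m < n)%N -> sigma_measurable G (f m)) ->
  sigma_measurable G (fun w => \sum_(m < n) f m w).
Proof.
elim: n => [_|n IH Gf].
  under eq_fun do rewrite big_ord0; exact: sigma_measurable_cst.
under eq_fun do rewrite big_ord_recr/=.
by apply: sigma_measurableD; [apply: IH => m mn; apply: Gf; exact: ltnW|exact: Gf].
Qed.

Lemma sigma_bigcap n (E : nat -> set T) : (forall m, (m < n)%N -> <<s G >> (E m)) ->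
  <<s G >> (\bigcap_(m in `I_n) E m).
Proof.
move=> GE.
by have := @bigcap_measurableType _ (g_sigma_algebraType G) E `I_n GE.
Qed.

End sigma_measurable.

Section brownian_past.
Context d (T : measurableType d) (R : realType) (P : probability T R).
Variable B : R -> {RV P >-> R}.

Lemma measurable_increment (s t : R) (A : set R) : measurable A ->
  measurable [set w | A (B t w - B s w)].
Proof.
move=> mA.
have : measurable_fun setT (fun w => B t w - B s w) by exact: measurable_funB.
by move=> /(_ measurableT A mA); rewrite setTI.
Qed.

Hypothesis BM : standard_brownian_motion B.

(** Only the rectangles, not the whole sigma-algebra of the increments: the
    definition of Brownian motion gives their probabilities, and they form a
    pi-system that generates this sigma-algebra. *)
Definition past_of_increments (s : nat -> R) (n : nat) : set (set T) :=
  [set E | exists A : nat -> set R, (forall m, measurable (A m)) /\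
    E = \bigcap_(m in `I_n) [set w | A m (B (s m.+1) w - B (s m) w)]].

Definition increasing_times (s : nat -> R) (n : nat) :=
  0 <= s 0%N /\ forall m, (m < n)%N -> s m <= s m.+1.

Lemma indep_past_of_increments s n (A : set R) : increasing_times s n.+1 ->
  measurable A ->
  indep_set P <<s past_of_increments s n>> [set w | A (B (s n.+1) w - B (s n) w)].
Proof.
move=> [s0 s_le] mA; apply: indep_set_sigma.
- exact: measurable_increment.
- move=> E [A' [mA' ->]]; apply: bigcap_measurableType => m _.
  exact: measurable_increment.
- move=> _ _ [A1 [mA1 ->]] [A2 [mA2 ->]].
  exists (fun m => A1 m `&` A2 m); split; first by move=> m; exact: measurableI.
  by rewrite -bigcapI.
move=> _ [A' [mA' ->]].
(* Independence of n + 1 increments, with the set A for the last one, and of the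
   first n increments: the two products differ by the last factor. *)
pose A'' m := if (m < n)%N then A' m else A.
have mA'' m : measurable (A'' m) by rewrite /A''; case: ifP.
have := bm_independent BM s0 s_le mA''.
rewrite big_ord_recr/= -(bm_independent BM s0 _ mA''); last first.
  by move=> m mn; apply: s_le; exact: ltnW.
rewrite {3}/A'' ltnn.
have -> : \bigcap_(m in `I_n) [set w | A'' m (B (s m.+1) w - B (s m) w)] =
  \bigcap_(m in `I_n) [set w | A' m (B (s m.+1) w - B (s m) w)].
  by apply: eq_bigcapr => m /= mn; rewrite /A'' mn.
move=> <-; congr (P _); apply/seteqP; split=> [w [Ew Aw] m /=|w Ew].
  rewrite ltnS leq_eqVlt => /orP[/eqP ->|mn]; rewrite /A'' ?ltnn ?mn//.
  exact: Ew.
split=> [m /= mn|/=].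
  by have := Ew m (ltnW mn); rewrite /A'' mn.
by have := Ew n (ltnSn n); rewrite /A'' ltnn.
Qed.

Lemma past_of_increments_sum s n j : (j <= n)%N ->
  sigma_measurable (past_of_increments s n) (fun w => B (s j) w - B (s 0%N) w).
Proof.
move=> jn.
under eq_fun do rewrite -(telescope_sumr (fun m => B (s m) _))// big_mkord.
apply: (@sigma_measurable_sum _ T R _ j (fun m w => B (s m.+1) w - B (s m) w)).
move=> m mj A mA; apply: sub_gen_smallest.
exists (fun k => if k == m then A else setT); split; first by move=> k; case: ifP.
apply/seteqP; split=> [w Aw k /= kn|w /(_ m)]; first by case: ifPn => // /eqP ->.
by rewrite /= eqxx; apply; exact: leq_trans jn.
Qed.

Let mB m (C : set R) : measurable C -> measurable (B m @^-1` C).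
Proof. by move=> mC; rewrite -[X in measurable X]setTI; exact: measurable_funP. Qed.

Let measurable_B0 : measurable [set w | B 0 w = 0].
Proof. exact: (mB _ (measurable_set1 0)). Qed.

Lemma bm_0_prob1 : P [set w | B 0 w = 0] = 1%E.
Proof.
have : P.-negligible (~` [set w | B 0 w = 0]) by exact: bm_0 BM.
move=> /(negligibleP P (measurableC measurable_B0)) PC0.
by rewrite -(setCK [set w | _]) probability_setC ?PC0 ?sube0//; exact: measurableC.
Qed.

(** The values of B on a grid starting at 0 are sums of increments on the event
    B 0 = 0.  This event has probability 1 but need not be everything, so the
    cylinder sets of B are compared with those of B - B 0 up to a null set. *)
Lemma indep_past_grid s n (A : set R) : increasing_times s n.+1 -> s 0%N = 0 ->
  measurable A ->
  indep_set P
    <<s \bigcup_(m in `I_n.+1) preimage_set_system setT (B (s m)) measurable >>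
    [set w | A (B (s n.+1) w - B (s n) w)].
Proof.
move=> ts s00 mA.
pose G := [set E | exists A' : nat -> set R, (forall m, measurable (A' m)) /\
    E = \bigcap_(m in `I_n.+1) B (s m) @^-1` A' m].
suff indG : indep_set P <<s G >> [set w | A (B (s n.+1) w - B (s n) w)].
  move=> E sE; apply: indG; move: E sE; apply: sub_smallest2r.
    exact: smallest_sigma_algebra.
  move=> E [m /= mn [C mC <-]]; rewrite setTI.
  exists (fun k => if k == m then C else setT); split; first by move=> k; case: ifP.
  apply/seteqP; split=> [w Aw k /= kn|w /(_ m mn)/=]; last by rewrite eqxx.
  by case: ifPn => // /eqP ->.
apply: indep_set_sigma.
- exact: measurable_increment.
- by move=> E [A' [mA' ->]]; apply: bigcap_measurableType => m _; exact: mB.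
- move=> _ _ [A1 [mA1 ->]] [A2 [mA2 ->]].
  exists (fun m => A1 m `&` A2 m); split; first by move=> m; exact: measurableI.
  by rewrite -bigcapI.
move=> _ [A' [mA' ->]].
pose E' := \bigcap_(m in `I_n.+1) (fun w => B (s m) w - B (s 0%N) w) @^-1` A' m.
have mE : measurable (\bigcap_(m in `I_n.+1) B (s m) @^-1` A' m).
  by apply: bigcap_measurableType => m _; exact: mB.
have sE' : <<s past_of_increments s n>> E'.
  by apply: sigma_bigcap => m mn; apply: past_of_increments_sum.
have mE' : measurable E'.
  apply: bigcap_measurableType => m _; exact: measurable_increment.
have mD := measurable_increment (s n) (s n.+1) mA.
have EE' : \bigcap_(m in `I_n.+1) B (s m) @^-1` A' m `&` [set w | B 0 w = 0] =
    E' `&` [set w | B 0 w = 0].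
  apply/seteqP; split=> w [Ew B0w]; split=> // m mn; have := Ew m mn;
    by rewrite /= s00 B0w subr0.
rewrite -(measure_setI_full (measurableI _ _ mE mD) measurable_B0 bm_0_prob1).
rewrite setIAC EE' setIAC.
rewrite (measure_setI_full (measurableI _ _ mE' mD) measurable_B0 bm_0_prob1).
rewrite (indep_past_of_increments ts mA sE'); congr (_ * _)%E.
rewrite -(measure_setI_full mE' measurable_B0 bm_0_prob1) -EE'.
exact: measure_setI_full mE measurable_B0 bm_0_prob1.
Qed.

(** The events that depend on finitely many times form a pi-system: two finite
    lists of times can be concatenated.  Sorting such a list, and adding 0, u
    and r, gives a grid to which [indep_past_grid] applies. *)
Lemma indep_brownian_past (u r : R) (A : set R) : 0 <= u -> u <= r ->
  measurable A ->
  indep_set P (process_sigma measurable (fun t => B t : T -> R) `[0, u])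
    [set w | A (B r w - B u w)].
Proof.
move=> u0 ur mA.
pose sigl (l : seq R) : set (set T) :=
  <<s \bigcup_(t in [set` l]) preimage_set_system setT (B t) measurable >>.
pose G := [set E | exists l : seq R, {subset l <= `[0, u]} /\ sigl l E].
have sub_sigl l l' : {subset l <= l'} -> sigl l `<=` sigl l'.
  by move=> ll'; apply: sub_sigma_algebra2; apply: bigcup_subset => t /=; exact: ll'.
have sigl_meas l : sigl l `<=` measurable.
  apply: smallest_sub; first exact: sigma_algebra_measurable.
  by move=> E [t _ [C mC <-]]; rewrite setTI; exact: mB.
suff indG : indep_set P <<s G >> [set w | A (B r w - B u w)].
  move=> E sE; apply: indG; move: E sE; apply: sub_sigma_algebra2.
  move=> E [t /= tu EB]; exists [:: t]; split.
    by move=> x; rewrite inE => /eqP ->.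
  by apply: sub_gen_smallest; exists t => //=; rewrite inE.
apply: indep_set_sigma.
- exact: measurable_increment.
- by move=> E [l [_]]; exact: sigl_meas.
- move=> E1 E2 [l1 [l1u E1l]] [l2 [l2u E2l]]; exists (l1 ++ l2); split.
    by move=> x; rewrite mem_cat => /orP[/l1u|/l2u].
  apply: (@measurableI _ (g_sigma_algebraType _)).
    by apply: sub_sigl E1l => x xl; rewrite mem_cat xl.
  by apply: sub_sigl E2l => x xl; rewrite mem_cat xl orbT.
move=> E [l [lu El]].
pose sl := 0 :: rcons (sort <=%R l) u.
(* The default value r is the time of index n + 1, just past the end of sl. *)
pose s := nth r sl.
pose n := (size l).+1.
have sn : s n = u.
  by rewrite /s /sl /n /= nth_rcons size_sort ltnn eqxx.
have snr : s n.+1 = r.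
  by rewrite /s /sl /n nth_default//= size_rcons size_sort.
have ts : increasing_times s n.+1.
  split=> // m; rewrite ltnS leq_eqVlt => /orP[/eqP ->|mn]; first by rewrite sn snr.
  have psl : path <=%R 0 (rcons (sort <=%R l) u).
    rewrite rcons_path path_min_sorted ?sort_le_sorted/=; last first.
      by apply/allP => x; rewrite mem_sort => /lu; rewrite in_itv => /andP[].
    have := mem_last 0 (sort <=%R l); rewrite inE => /predU1P[->//|].
    by rewrite mem_sort => /lu; rewrite in_itv => /andP[].
  by have /(pathP r) := psl; apply; rewrite size_rcons size_sort.
have := @indep_past_grid s n A ts erefl mA; rewrite snr sn; apply.
move: E El; apply: sub_sigma_algebra2 => E [t /= tl EB].
exists (index t (sort <=%R l)).+1.
  by rewrite /= ltnS /n ltnS -(size_sort <=%R) index_size.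
by rewrite /s /sl/= nth_rcons index_mem mem_sort tl nth_index// mem_sort.
Qed.

End brownian_past.

Section joint_past.
Context d (T : measurableType d) (R : realType) (P : probability T R).
Variables (k : nat) (X : R -> T -> 'I_k) (B : R -> {RV P >-> R}).
Hypothesis BM : standard_brownian_motion B.
Hypothesis X_meas : forall (t : R) j, 0 <= t -> measurable [set w | X t w = j].
Hypothesis XB : forall E G : set T,
    process_sigma setT X `[0, +oo[ E ->
    process_sigma measurable (fun t => B t : T -> R) `[0, +oo[ G ->
    P (E `&` G) = (P E * P G)%E.

(** The natural filtration of the pair (X, B). *)
Definition joint_filtration (u : R) : set (set T) :=
  <<s process_sigma setT X `[0, u] `|`
      process_sigma measurable (fun t => B t : T -> R) `[0, u] >>.

Lemma process_sigma_sub (U : Type) (S : set (set U)) (Y : R -> T -> U)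
    (I J : set R) :
  I `<=` J -> process_sigma S Y I `<=` process_sigma S Y J.
Proof. by move=> IJ; apply: sub_sigma_algebra2; exact: bigcup_subset. Qed.

Lemma process_sigma_X_measurable (I : set R) : I `<=` `[0, +oo[ ->
  process_sigma setT X I `<=` measurable.
Proof.
move=> I0; apply: smallest_sub; first exact: sigma_algebra_measurable.
move=> E [t /I0]; rewrite /= in_itv/= andbT => t0 [C _ <-]; rewrite setTI.
rewrite (_ : _ @^-1` C = \bigcup_(j in C) [set w | X t w = j]).
  by apply: fin_bigcup_measurable => // j _; exact: X_meas.
by apply/seteqP; split=> [w Cw|w [j Cj /= ->]//]; exists (X t w).
Qed.

Lemma process_sigma_B_measurable (I : set R) :
  process_sigma measurable (fun t => B t : T -> R) I `<=` measurable.
Proof.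
apply: smallest_sub; first exact: sigma_algebra_measurable.
by move=> E [t _ [C mC <-]]; exact: measurable_funP.
Qed.

Lemma joint_filtration_measurable u : joint_filtration u `<=` measurable.
Proof.
apply: smallest_sub; first exact: sigma_algebra_measurable.
move=> E []; last exact: process_sigma_B_measurable.
by apply: process_sigma_X_measurable; apply: subset_itvl.
Qed.

Lemma joint_filtration_mono u v : u <= v ->
  joint_filtration u `<=` joint_filtration v.
Proof.
move=> uv; apply: sub_sigma_algebra2.
by apply: setUSS; apply: process_sigma_sub; apply: subset_itvl.
Qed.

(** Intersections of an event of X up to u with an event of B up to u form a
    pi-system.  An event of X is independent of all of B, and an event of B up
    to u is independent of the increment, so the probability of the triple
    intersection factors. *)
Lemma indep_joint_filtration (u r : R) (A : set R) : 0 <= u -> u <= r ->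
  measurable A -> indep_set P (joint_filtration u) [set w | A (B r w - B u w)].
Proof.
move=> u0 ur mA.
pose D := [set w | A (B r w - B u w)].
have mD : measurable D by exact: (measurable_increment B u r mA).
pose FX := process_sigma setT X `[0, u].
pose FB := process_sigma measurable (fun t => B t : T -> R) `[0, u].
pose G := [set E | exists E1 E2, [/\ FX E1, FB E2 & E = E1 `&` E2]].
have sub0 : `[0, u] `<=` `[0, +oo[ by apply: subset_itvl.
have FXm := @process_sigma_X_measurable `[0, u] sub0.
have FBm := @process_sigma_B_measurable `[0, u].
have sD : process_sigma measurable (fun t => B t : T -> R) `[0, +oo[ D.
  have sB t : 0 <= t -> sigma_measurable
      (\bigcup_(s in `[0, +oo[) preimage_set_system setT (B s : T -> R) measurable)
      (B t).
    move=> t0 C mC; apply: sub_gen_smallest; exists t.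
      by rewrite /= in_itv/= t0.
    by exists C => //; rewrite setTI.
  have := sigma_measurableB (sB r (le_trans u0 ur)) (sB u u0).
  exact.
suff indG : indep_set P <<s G >> D.
  move=> E sE; apply: indG; move: E sE; apply: sub_sigma_algebra2.
  move=> E [FE|FE].
    exists E, setT; split=> //; last by rewrite setIT.
    exact: (@measurableT _ (g_sigma_algebraType _)).
  exists setT, E; split=> //; last by rewrite setTI.
  exact: (@measurableT _ (g_sigma_algebraType _)).
apply: indep_set_sigma => //.
- by move=> E [E1 [E2 [FE1 FE2 ->]]]; apply: measurableI; [exact: FXm|exact: FBm].
- move=> E E' [E1 [E2 [FE1 FE2 ->]]] [E1' [E2' [FE1' FE2' ->]]].
  exists (E1 `&` E1'), (E2 `&` E2'); split; last by rewrite setIACA.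
    exact: (@measurableI _ (g_sigma_algebraType _)).
  exact: (@measurableI _ (g_sigma_algebraType _)).
- move=> _ [E1 [E2 [FE1 FE2 ->]]].
  have FE1y := process_sigma_sub sub0 FE1.
  have FE2y := process_sigma_sub sub0 FE2.
  rewrite -setIA XB//; last exact: (@measurableI _ (g_sigma_algebraType _)).
  by rewrite (indep_brownian_past BM u0 ur mA FE2) XB// muleA.
Qed.

End joint_past.

(** * The Ito isometry for simple integrands *)

Section ito_isometry.
Context d (T : measurableType d) (R : realType) (P : probability T R).
Variables (k : nat) (X : R -> T -> 'I_k) (B : R -> {RV P >-> R}).
Hypothesis BM : standard_brownian_motion B.
Hypothesis X_meas : forall (t : R) j, 0 <= t -> measurable [set w | X t w = j].
Hypothesis XB : forall E G : set T,
    process_sigma setT X `[0, +oo[ E ->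
    process_sigma measurable (fun t => B t : T -> R) `[0, +oo[ G ->
    P (E `&` G) = (P E * P G)%E.

Definition adapted (u : R) (f : T -> R) :=
  forall A, measurable A -> joint_filtration X B u (f @^-1` A).

Lemma adapted_measurable u f : adapted u f -> measurable_fun setT f.
Proof.
move=> Ff _ A mA; rewrite setTI.
exact: (joint_filtration_measurable X_meas (Ff A mA)).
Qed.

Lemma adapted_mono u v f : u <= v -> adapted u f -> adapted v f.
Proof. by move=> uv Ff A mA; apply: joint_filtration_mono uv _ (Ff A mA). Qed.

Lemma adapted_brownian u : 0 <= u -> adapted u (B u).
Proof.
move=> u0 A mA; apply: sub_gen_smallest; right; apply: sub_gen_smallest.
exists u; first by rewrite /= in_itv/= u0 lexx.
by exists A => //; rewrite setTI.
Qed.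

Lemma adapted_increment u r : 0 <= u -> u <= r -> adapted r (fun w => B r w - B u w).
Proof.
move=> u0 ur; apply: sigma_measurableB.
  by apply: adapted_brownian; exact: le_trans ur.
by apply: adapted_mono ur _; exact: adapted_brownian.
Qed.

Let inc u r w := B r w - B u w.

Lemma increment_moments u r : 0 <= u -> u <= r ->
  [/\ inc u r \in Lfun P 2%:E, \int[P]_w inc u r w = 0 &
      \int[P]_w (inc u r w * inc u r w) = r - u].
Proof.
move=> u0; rewrite le_eqVlt => /predU1P[<-|ur].
  have -> : inc u u = cst 0 by apply/funext => w; rewrite /inc subrr.
  split; first exact: Lfun_cst.
    by rewrite /Rintegral integral0.
  by under eq_Rintegral do rewrite mulr0; rewrite subrr /Rintegral integral0.
have minc : measurable_fun setT (inc u r) by exact: measurable_funB.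
have s0 : Num.sqrt (r - u) != 0 by rewrite sqrtr_eq0 -ltNge subr_gt0.
have law := bm_normal BM u0 ur.
split.
- exact: (Lfun2_normal minc s0 law).
- by rewrite /Rintegral (integral_normal minc s0 law).
- by rewrite /Rintegral (integral_sqr_normal minc s0 law) sqr_sqrtr ?subr_ge0 ?ltW.
Qed.

Let sub1 f : f \in Lfun P 2%:E -> f \in Lfun P 1.
Proof. by apply: Lfun_subset12; exact: fin_num_measure. Qed.

Let indep u r f (g : R -> R) : 0 <= u -> u <= r -> adapted u f ->
  measurable_fun setT g ->
  forall A C : set R, measurable A -> measurable C ->
  P (f @^-1` A `&` (fun w => g (inc u r w)) @^-1` C) =
  (P (f @^-1` A) * P ((fun w => g (inc u r w)) @^-1` C))%E.
Proof.
move=> u0 ur Ff mg A C mA mC.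
have mgC : measurable (g @^-1` C) by rewrite -[X in measurable X]setTI; exact: mg.
exact: (indep_joint_filtration BM X_meas XB u0 ur mgC (Ff A mA)).
Qed.

Lemma Rintegral_adapted_mul_increment u r f : 0 <= u -> u <= r -> adapted u f ->
  f \in Lfun P 1 -> \int[P]_w (f w * inc u r w) = 0.
Proof.
move=> u0 ur Ff f1; have [/sub1 i1 i0 _] := increment_moments u0 ur.
rewrite (Rintegral_indepM (adapted_measurable Ff)) ?i0 ?mulr0//.
  exact: measurable_funB.
by move=> A C mA mC; apply: (indep (g := id)).
Qed.

Lemma Lfun1_sqr f : f \in Lfun P 2%:E -> (fun w => f w * f w) \in Lfun P 1.
Proof. by move=> f2; exact: Lfun2_mul_Lfun1. Qed.

Lemma Rintegral_adapted_mul_increment_sqr u r f : 0 <= u -> u <= r ->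
  adapted u f -> f \in Lfun P 1 ->
  (fun w => f w * (inc u r w * inc u r w)) \in Lfun P 1 /\
  \int[P]_w (f w * (inc u r w * inc u r w)) = (r - u) * \int[P]_w f w.
Proof.
move=> u0 ur Ff f1; have [/Lfun1_sqr i1 _ i2] := increment_moments u0 ur.
have minc : measurable_fun setT (inc u r) by exact: measurable_funB.
have minc2 : measurable_fun setT (fun w => inc u r w * inc u r w).
  exact: measurable_funM.
have ind : forall A C : set R, measurable A -> measurable C ->
  P (f @^-1` A `&` (fun w => inc u r w * inc u r w) @^-1` C) =
  (P (f @^-1` A) * P ((fun w => inc u r w * inc u r w)%R @^-1` C))%E.
  by apply: (indep (g := fun x => x * x)) => //; exact: measurable_funM.
split; first exact: (Lfun1_indepM (adapted_measurable Ff) minc2 ind f1 i1).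
by rewrite (Rintegral_indepM (adapted_measurable Ff) minc2 ind f1 i1) i2 mulrC.
Qed.

Lemma Lfun2_adapted_mul_increment u r f : 0 <= u -> u <= r -> adapted u f ->
  f \in Lfun P 2%:E -> (fun w => f w * inc u r w) \in Lfun P 2%:E.
Proof.
move=> u0 ur Ff f2; apply: integrable_sqr_Lfun2.
  by apply: measurable_funM; [exact: adapted_measurable Ff|exact: measurable_funB].
have Fff : adapted u (fun w => f w * f w) by exact: sigma_measurableM.
have [/Lfun1_integrable/integrableP[_ h] _] :=
  Rintegral_adapted_mul_increment_sqr u0 ur Fff (Lfun1_sqr f2).
move: h; congr (_ < _)%E; apply: eq_integral => w _ /=; congr EFin.
by rewrite -mulrACA -expr2 ger0_norm// sqr_ge0.
Qed.

Lemma adapted_affine u r I v : 0 <= u -> u <= r -> adapted u I -> adapted u v ->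
  adapted r (fun w => I w + v w * inc u r w).
Proof.
move=> u0 ur FI Fv; apply: sigma_measurableD; first exact: adapted_mono FI.
apply: sigma_measurableM; first exact: adapted_mono Fv.
exact: adapted_increment.
Qed.

(** One step of the Ito isometry, in polarized form.  In the product, the two
    cross terms are means of an adapted variable times the increment, hence 0,
    and the last term is the mean of the adapted variable v v' times the square
    of the increment, whose mean is r - u. *)
Lemma ito_step u r I J v v' : 0 <= u -> u <= r ->
  adapted u I -> adapted u J -> adapted u v -> adapted u v' ->
  I \in Lfun P 2%:E -> J \in Lfun P 2%:E ->
  v \in Lfun P 2%:E -> v' \in Lfun P 2%:E ->
  \int[P]_w ((I w + v w * inc u r w) * (J w + v' w * inc u r w)) =
  \int[P]_w (I w * J w) + (r - u) * \int[P]_w (v w * v' w).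
Proof.
move=> u0 ur FI FJ Fv Fv' I2 J2 v2 v'2.
have vi2 := Lfun2_adapted_mul_increment u0 ur Fv v2.
have v'i2 := Lfun2_adapted_mul_increment u0 ur Fv' v'2.
have Lsg := Lfun2D J2 v'i2.
rewrite Rintegral_Lfun2DM// !Rintegral_Lfun2MD//.
have cross f g : adapted u f -> adapted u g -> f \in Lfun P 2%:E ->
    g \in Lfun P 2%:E -> \int[P]_w (f w * (g w * inc u r w)) = 0.
  move=> Ff Fg f2 g2; under eq_Rintegral do rewrite mulrA.
  rewrite (@Rintegral_adapted_mul_increment u r (fun w => f w * g w))//.
    exact: sigma_measurableM.
  exact: Lfun2_mul_Lfun1.
rewrite cross// (Rintegral_Lfun2MC P (fun w => v w * inc u r w)) cross// addr0 add0r.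
congr (_ + _); under eq_Rintegral do rewrite mulrACA.
have Fvv : adapted u (fun w => v w * v' w) by exact: sigma_measurableM.
have vv1 := Lfun2_mul_Lfun1 v2 v'2.
by have [_ ->] := Rintegral_adapted_mul_increment_sqr u0 ur Fvv vv1.
Qed.

Section simple_sums.
Variables (N : nat) (s : nat -> R).
Hypothesis s0 : 0 <= s 0%N.
Hypothesis s_le : forall m, (m < N)%N -> s m <= s m.+1.

Let s_ge0 m : (m <= N)%N -> 0 <= s m.
Proof.
elim: m => [//|m IH mN]; apply: le_trans (s_le mN); apply: IH; exact: ltnW.
Qed.

(** The initial value I0 makes constants and the Brownian motion itself sums of
    this form: B (s n) has initial value B (s 0) and integrand 1. *)
Definition ito_sum (I0 : T -> R) (v : nat -> T -> R) (n : nat) (w : T) : R :=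
  I0 w + \sum_(m < n) v m w * (B (s m.+1) w - B (s m) w).

Definition square_integrable_integrand (v : nat -> T -> R) := forall m, (m < N)%N ->
  adapted (s m) (v m) /\ v m \in Lfun P 2%:E.

Lemma ito_sumS I0 v n : ito_sum I0 v n.+1 =
  fun w => ito_sum I0 v n w + v n w * inc (s n) (s n.+1) w.
Proof. by apply/funext => w; rewrite /ito_sum big_ord_recr/= addrA. Qed.

Lemma ito_sum0 I0 v : ito_sum I0 v 0 = I0.
Proof. by apply/funext => w; rewrite /ito_sum big_ord0 addr0. Qed.

Lemma ito_sum_Lfun2 I0 v n : (n <= N)%N -> adapted (s 0%N) I0 ->
  I0 \in Lfun P 2%:E -> square_integrable_integrand v ->
  adapted (s n) (ito_sum I0 v n) /\ ito_sum I0 v n \in Lfun P 2%:E.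
Proof.
move=> + FI0 I02 sv; elim: n => [_|n IH nN]; first by rewrite ito_sum0.
have [FI I2] := IH (ltnW nN); have [Fv v2] := sv _ nN.
have sn0 := s_ge0 (ltnW nN); have snS := s_le nN.
rewrite ito_sumS; split; first exact: adapted_affine.
by apply: Lfun2D => //; exact: Lfun2_adapted_mul_increment.
Qed.

Lemma ito_isometry I0 J0 v v' n : (n <= N)%N ->
  adapted (s 0%N) I0 -> adapted (s 0%N) J0 ->
  I0 \in Lfun P 2%:E -> J0 \in Lfun P 2%:E ->
  square_integrable_integrand v -> square_integrable_integrand v' ->
  \int[P]_w (ito_sum I0 v n w * ito_sum J0 v' n w) =
  \int[P]_w (I0 w * J0 w) +
  \sum_(m < n) (s m.+1 - s m) * \int[P]_w (v m w * v' m w).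
Proof.
move=> + FI0 FJ0 I02 J02 sv sv'; elim: n => [_|n IH nN].
  by rewrite !ito_sum0 big_ord0 addr0.
have [FI I2] := ito_sum_Lfun2 (ltnW nN) FI0 I02 sv.
have [FJ J2] := ito_sum_Lfun2 (ltnW nN) FJ0 J02 sv'.
have [Fv v2] := sv _ nN; have [Fv' v'2] := sv' _ nN.
have sn0 := s_ge0 (ltnW nN); have snS := s_le nN.
rewrite !ito_sumS ito_step// IH ?(ltnW nN)// big_ord_recr/= addrA//.
Qed.

End simple_sums.
End ito_isometry.

(** * Step processes and right-continuous processes on the product space *)

Section step_functions.
Context {R : realType}.
Variables (N : nat) (s : nat -> R).
Hypothesis s_le : forall m, (m < N)%N -> s m <= s m.+1.

Let step m : R -> R := \1_(`]s m, s m.+1]%classic).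

Lemma times_le m n : (m <= n)%N -> (n <= N)%N -> s m <= s n.
Proof.
move=> mn; elim: n mn => [|n IH]; first by rewrite leqn0 => /eqP ->.
rewrite leq_eqVlt => /predU1P[-> //|mn nN].
by apply: le_trans (s_le nN); apply: IH => //; exact: ltnW.
Qed.

Lemma step_disjoint m n x : (m < n)%N -> (n < N)%N -> step m x * step n x = 0.
Proof.
move=> mn nN; rewrite /step !indicE !mem_setE !in_itv/=.
have := times_le mn (ltnW nN).
case: (ltP (s n) x) => [snx smn|_ _]; last by rewrite mulr0.
by rewrite [x <= _]leNgt (le_lt_trans smn snx)/= andbF mul0r.
Qed.

(** The intervals are pairwise disjoint, so all the cross terms vanish. *)
Lemma step_sumM (a b : nat -> R) n x : (n <= N)%N ->
  (\sum_(m < n) a m * step m x) * (\sum_(m < n) b m * step m x) =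
  \sum_(m < n) a m * b m * step m x.
Proof.
elim: n => [_|n IH nN]; first by rewrite !big_ord0 mul0r.
rewrite !big_ord_recr/= -IH ?(ltnW nN)//.
have vanish (c : nat -> R) : (\sum_(m < n) c m * step m x) * step n x = 0.
  rewrite mulr_suml big1// => m _; rewrite -mulrA step_disjoint ?mulr0//.
have sq : step n x * step n x = step n x.
  by rewrite /step indicE; case: (_ \in _); rewrite ?mulr1 ?mulr0.
rewrite mulrDl !mulrDr (mulrCA (\sum_(_ < n) _ * _)) vanish mulr0.
rewrite -!mulrA (mulrC (step n x)) vanish mulr0 addr0 add0r.
by rewrite (mulrCA (step n x)) sq.
Qed.

End step_functions.

(** A step process is the value at (w, x) of a simple process with values v held
    on the intervals of the grid s.  Its inner products over T x R are the sums
    that occur in the Ito isometry. *)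
Section step_processes.
Context d (T : measurableType d) (R : realType) (P : probability T R).
Variables (N : nat) (s : nat -> R).
Hypothesis s_le : forall m, (m < N)%N -> s m <= s m.+1.

Let Q := (P \x @lebesgue_measure R)%E.

Definition step_process (v : nat -> T -> R) (z : T * R) : R :=
  \sum_(m < N) v m z.1 * \1_(`]s m, s m.+1]%classic) z.2.

Let Lfun1_itv (a b : R) :
  (\1_(`]a, b]%classic) : R -> R) \in Lfun (@lebesgue_measure R) 1.
Proof. apply/Lfun1_integrable; exact: integrable_indic_itv. Qed.

Let Rintegral_itv (a b : R) : a <= b ->
  \int[@lebesgue_measure R]_x (\1_(`]a, b]%classic) x : R) = b - a.
Proof.
move=> ab; rewrite /Rintegral integral_indic//= setIT lebesgue_measure_itv/=.
rewrite lte_fin; case: ltP => [//|ba].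
by rewrite (@le_anti _ _ a b) ?ab// subrr.
Qed.

Lemma Rintegral_step_process (v : nat -> T -> R) :
  (forall m, (m < N)%N -> v m \in Lfun P 1) ->
  step_process v \in Lfun Q 1 /\
  \int[Q]_z step_process v z = \sum_(m < N) (s m.+1 - s m) * \int[P]_w v m w.
Proof.
rewrite /step_process; move: s_le; elim: N => [|n IH] sle v1.
  under eq_fun do rewrite big_ord0.
  split; last by rewrite big_ord0 /Rintegral integral0.
  apply/Lfun1_integrable; exact: integrable0.
have [I1 I2] := IH (fun m mn => sle m (ltnW mn)) (fun m mn => v1 m (ltnW mn)).
have vn := v1 n (ltnSn n).
have t1 := @Lfun1_tensor _ _ _ _ R P lebesgue_measure (v n) _ vn
  (Lfun1_itv (s n) (s n.+1)).
have t2 := @Rintegral_tensor _ _ _ _ R P lebesgue_measure (v n) _ vn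
  (Lfun1_itv (s n) (s n.+1)).
split.
  under eq_fun do rewrite big_ord_recr/=.
  by apply: rpredD.
under eq_Rintegral do rewrite big_ord_recr/=.
rewrite RintegralD//; last 2 first.
- exact/Lfun1_integrable.
- exact/Lfun1_integrable.
by rewrite I2 t2 big_ord_recr/= Rintegral_itv ?sle// mulrC.
Qed.

Lemma step_processM (v v' : nat -> T -> R) z :
  step_process v z * step_process v' z = step_process (fun m w => v m w * v' m w) z.
Proof.
exact: (step_sumM s_le (fun m => v m z.1) (fun m => v' m z.1) z.2 (leqnn N)).
Qed.

Lemma Lfun2_step_process v : (forall m, (m < N)%N -> v m \in Lfun P 2%:E) ->
  step_process v \in Lfun Q 2%:E.
Proof.
move=> v2; have v1 m : (m < N)%N -> v m \in Lfun P 1.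
  by move=> mN; apply: Lfun_subset12 (v2 m mN); exact: fin_num_measure.
have [/Lfun1_integrable/integrableP[/measurable_EFinP mv _] _] :=
  Rintegral_step_process v1.
apply: integrable_sqr_Lfun2 => //.
have vv1 m : (m < N)%N -> (fun w => v m w * v m w) \in Lfun P 1.
  by move=> mN; apply: Lfun2_mul_Lfun1; exact: v2.
have [/Lfun1_integrable/integrableP[_ h] _] := Rintegral_step_process vv1.
move: h; congr (_ < _)%E; apply: eq_integral => z _ /=; congr EFin.
by rewrite -step_processM -expr2 ger0_norm// sqr_ge0.
Qed.

Lemma Rintegral_step_processM v v' : (forall m, (m < N)%N -> v m \in Lfun P 2%:E) ->
  (forall m, (m < N)%N -> v' m \in Lfun P 2%:E) ->
  \int[Q]_z (step_process v z * step_process v' z) =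
  \sum_(m < N) (s m.+1 - s m) * \int[P]_w (v m w * v' m w).
Proof.
move=> v2 v'2; have vv1 m : (m < N)%N -> (fun w => v m w * v' m w) \in Lfun P 1.
  by move=> mN; apply: Lfun2_mul_Lfun1; [exact: v2|exact: v'2].
under eq_Rintegral do rewrite step_processM.
by have [_ ->] := Rintegral_step_process vv1.
Qed.

End step_processes.

Section right_continuous_process.
Context d (T : measurableType d) (R : realType) (k : nat).
Variable X : R -> T -> 'I_k.
Hypothesis X_meas : forall (t : R) j, 0 <= t -> measurable [set w | X t w = j].
Hypothesis X_rc : forall w (t : R), 0 <= t -> \forall s \near t^'+, X s w = X t w.

Lemma measurable_jump_state (g : 'I_k -> R) (t : R) : 0 <= t ->
  measurable_fun setT (fun w => g (X t w)).
Proof.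
move=> t0 _ A mA; rewrite setTI.
rewrite (_ : _ @^-1` A = \bigcup_(j in [set j | A (g j)]) [set w | X t w = j]).
  by apply: fin_bigcup_measurable => // j _; exact: X_meas.
by apply/seteqP; split=> [w Cw|w [j Cj /= ->]//]; exists (X t w).
Qed.

Let grid (n j : nat) : R := j%:R / n.+1%:R.

(** The process read, at a time x of [0, t], at the next grid point strictly to
    the right of x: it is a finite sum of products, and it converges to the
    process by right-continuity. *)
Let approx (g : 'I_k -> R) (t : R) (n : nat) (z : T * R) : R :=
  \sum_(j < (Num.truncn (t * n.+1%:R)).+1)
    g (X (grid n j.+1) z.1) *
      \1_(`[grid n j, grid n j.+1[%classic `&` `[0, t]%classic) z.2.

Let grid_ge0 n j : 0 <= grid n j.
Proof. by rewrite divr_ge0. Qed.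

Let approxE g t n w (x : R) : 0 <= x <= t ->
  approx g t n (w, x) = g (X (grid n (Num.truncn (x * n.+1%:R)).+1) w).
Proof.
move=> /andP[x0 xt]; rewrite /approx.
have n0 : 0 < n.+1%:R :> R by rewrite ltr0n.
have xn0 : 0 <= x * n.+1%:R by rewrite mulr_ge0.
have /andP[lo hi] := truncn_itv xn0.
have jlt : (Num.truncn (x * n.+1%:R) < (Num.truncn (t * n.+1%:R)).+1)%N.
  rewrite ltnS; apply: le_truncn; exact: ler_wpM2r.
rewrite (bigD1 (Ordinal jlt))//= big1 ?addr0.
  rewrite indicE mem_set ?mulr1//; split=> /=; rewrite in_itv/= ?x0//.
  by rewrite /grid ler_pdivrMr// lo ltr_pdivlMr.
move=> j /eqP jne; rewrite indicE memNset ?mulr0// => -[/=].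
rewrite in_itv/= /grid ler_pdivrMr// ltr_pdivlMr// => /andP[jlo jhi] _.
apply: jne; apply: val_inj => /=; apply/esym; apply: truncn_def.
by rewrite jlo jhi.
Qed.

Lemma measurable_right_continuous_process (g : 'I_k -> R) (t : R) :
  measurable_fun setT (fun z : T * R => g (X z.2 z.1) * \1_(`[0, t]%classic) z.2).
Proof.
apply: (measurable_fun_cvg (h := approx g t)) => [n|[w x] _].
  rewrite /approx; apply: measurable_sum => j.
  apply: measurable_funM.
    apply: (measurableT_comp (f := fun w => g (X (grid n j.+1) w))) => //.
    exact: measurable_jump_state.
  apply: measurableT_comp => //; apply: measurable_indic; exact: measurableI.
have [x0t|x0t] := boolP (x \in `[0, t]); last first.
  rewrite indicE memNset/= ?mulr0; last exact/negP.
  apply: cvg_near_cst; apply: nearW => n; rewrite /approx big1// => j _.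
  by rewrite indicE memNset ?mulr0// => -[_] /=; exact/negP.
have /andP[x0 xt] : 0 <= x <= t by rewrite in_itv in x0t.
rewrite indicE mem_set//= mulr1.
have /nbhs_ballP[e /= e0 He] := X_rc w x0.
apply: cvg_near_cst; near=> n.
rewrite approxE ?x0//; congr (g _); apply: He.
  rewrite /ball/= /grid.
  have n0 : 0 < n.+1%:R :> R by rewrite ltr0n.
  have /truncn_itv/andP[lo hi] : 0 <= x * n.+1%:R by rewrite mulr_ge0.
  rewrite ltr0_norm ?subr_lt0 ?ltr_pdivlMr// opprB ltrBlDr ltr_pdivrMr//.
  have eN : 1 < e * n.+1%:R.
    rewrite -ltr_pdivrMr// div1r; near: n.
    exact: (near_infty_natSinv_lt (PosNum e0)).
  by rewrite -natr1 mulrDl addrC; apply: ltr_leD.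
rewrite /grid ltr_pdivlMr ?ltr0n//.
by have /truncn_itv/andP[] : 0 <= x * n.+1%:R by rewrite mulr_ge0.
Unshelve. all: by end_near. Qed.

End right_continuous_process.

(** * The two-state transition semigroup *)

Lemma norm_subX (R : realDomainType) (a b : R) n :
  `|a| <= 1 -> `|b| <= 1 -> `|a ^+ n - b ^+ n| <= n%:R * `|a - b|.
Proof.
move=> a1 b1; elim: n => [|n IH]; first by rewrite subrr normr0 mul0r.
rewrite !exprS (_ : _ - _ = a * (a ^+ n - b ^+ n) + (a - b) * b ^+ n); last by ring.
apply: le_trans (ler_normD _ _) _; rewrite -natr1 [leRHS]mulrDl mul1r !normrM.
apply: lerD; first by apply: le_trans IH; rewrite ler_piMl.
by rewrite ler_piMr// normrX exprn_ile1.
Qed.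

Section two_state_semigroup.
Context {R : realType}.
Variables (alpha beta : R) (p : R -> 'M[R]_2).
Hypothesis lambda_gt0 : 0 < alpha + beta.
Hypothesis tp : transition_function (alternating_Q alpha beta) p.

Let q (t : R) : R := p t 0 1.
Let r (t : R) : R := p t 1 0.
(** The determinant, and second eigenvalue, of the stochastic matrix p t. *)
Let g (t : R) : R := 1 - q t - r t.

Let sum2 (f : 'I_2 -> R) : \sum_j f j = f 0 + f 1.
Proof.
rewrite big_ord_recl big_ord1; congr (f _ + f _); exact: val_inj.
Qed.

Let p00 t : 0 <= t -> p t 0 0 = 1 - q t.
Proof. by move=> t0; rewrite -(transition_sum1 tp 0 t0) sum2 addrK. Qed.

Let p11 t : 0 <= t -> p t 1 1 = 1 - r t.
Proof. by move=> t0; rewrite -(transition_sum1 tp 1 t0) sum2 addrC addKr. Qed.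

Let qD s t : 0 <= s -> 0 <= t -> q (s + t) = q t + q s * g t.
Proof.
move=> s0 t0; rewrite {1}/q (transition_semigroup tp s0 t0) mxE sum2.
by rewrite p00// p11// -/(q t) -/(q s) /g; ring.
Qed.

Let rD s t : 0 <= s -> 0 <= t -> r (s + t) = r t + r s * g t.
Proof.
move=> s0 t0; rewrite {1}/r (transition_semigroup tp s0 t0) mxE sum2.
by rewrite p00// p11// -/(r t) -/(r s) /g; ring.
Qed.

Let gD s t : 0 <= s -> 0 <= t -> g (s + t) = g s * g t.
Proof. by move=> s0 t0; rewrite {1}/g qD// rD// /g; ring. Qed.

Let g0 : g 0 = 1.
Proof. by rewrite /g /q /r (transition_0 tp) !mxE/= !subr0. Qed.

Let gX n h : 0 <= h -> g (n%:R * h) = g h ^+ n.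
Proof.
move=> h0; elim: n => [|n IH]; first by rewrite mul0r g0.
by rewrite -natr1 mulrDl mul1r gD ?mulr_ge0// IH exprSr.
Qed.

Let g_le1 t : 0 <= t -> `|g t| <= 1.
Proof.
move=> t0; have := transition_ge0 tp 0 1 t0; have := transition_ge0 tp 1 0 t0.
have := transition_ge0 tp 0 0 t0; have := transition_ge0 tp 1 1 t0.
rewrite p00// p11// -/(q t) -/(r t) /g ler_norml => ? ? ? ?.
by apply/andP; split; lra.
Qed.

Let dq : h^-1 * q h @[h --> 0^'+] --> alpha.
Proof.
have := @transition_intensity _ _ _ _ tp 0 1; rewrite (transition_0 tp) !mxE/=.
by under eq_fun do rewrite subr0.
Qed.

Let dr : h^-1 * r h @[h --> 0^'+] --> beta.
Proof.
have := @transition_intensity _ _ _ _ tp 1 0; rewrite (transition_0 tp) !mxE/=.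
by under eq_fun do rewrite subr0.
Qed.

Let dg : h^-1 * (1 - g h) @[h --> 0^'+] --> alpha + beta.
Proof.
rewrite (_ : (fun h => _) = fun h => h^-1 * q h + h^-1 * r h).
  by apply: cvgD; [exact: dq|exact: dr].
by apply/funext => h; rewrite /g; ring.
Qed.

(** Exchanging s and h in p (s + h) shows that q s (1 - g h) = q h (1 - g s);
    divide by h and let h tend to 0. *)
Let qE s : 0 <= s -> q s * (alpha + beta) = alpha * (1 - g s).
Proof.
move=> s0.
have c1 : q s * (h^-1 * (1 - g h)) @[h --> 0^'+] --> q s * (alpha + beta).
  by apply: cvgM; [exact: cvg_cst|exact: dg].
have c2 : h^-1 * q h * (1 - g s) @[h --> 0^'+] --> alpha * (1 - g s).
  by apply: cvgM; [exact: dq|exact: cvg_cst].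
apply: (cvg_unique _ c1) => //; apply: cvg_trans c2; apply: near_eq_cvg.
near=> h; have h0 : 0 <= h by near: h; exact: nbhs_right_ge.
have := qD s0 h0; rewrite addrC qD// => E.
have {}E : q h * (1 - g s) = q s * (1 - g h).
  by move: (q s) (q h) (g s) (g h) E => a b c e E; lra.
by rewrite -mulrA E mulrCA.
Unshelve. all: by end_near. Qed.

Let dexp : h^-1 * (1 - expR (- ((alpha + beta) * h))) @[h --> 0^'+] --> alpha + beta.
Proof.
pose f (h : R) := 1 - expR (- ((alpha + beta) * h)).
have df : is_derive (0 : R) 1 f (alpha + beta).
  apply: is_derive_eq; rewrite /GRing.scale/= !mulr0 oppr0 expR0; ring.
have f0 : f 0 = 0 by rewrite /f mulr0 oppr0 expR0 subrr.
have [dd dE] := df.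
have : h^-1 *: (f (h *: 1 + 0) - f 0) @[h --> 0^'] --> alpha + beta.
  by rewrite -dE; exact: dd.
move/cvg_dnbhs_at_right; apply: cvg_trans; apply: near_eq_cvg.
by near=> h; rewrite /GRing.scale/= mulr1 addr0 f0 subr0.
Unshelve. all: by end_near. Qed.

(** Both sides are multiplicative in s and bounded by 1, so they differ by at
    most n |g (s / n) - exp (- lambda s / n)|, where lambda = alpha + beta.  This
    tends to 0 because both functions have right derivative - lambda at 0. *)
Lemma two_state_eigenvalue s : 0 <= s -> g s = expR (- ((alpha + beta) * s)).
Proof.
rewrite le_eqVlt => /predU1P[<-|s0]; first by rewrite g0 mulr0 oppr0 expR0.
pose e h := expR (- ((alpha + beta) * h)).
have e_le1 h : 0 <= h -> `|e h| <= 1.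
  move=> h0; rewrite ger0_norm ?expR_ge0// -expR0 ler_expR oppr_le0.
  by rewrite mulr_ge0// ltW.
pose u (h : R) : R := `|h^-1 * (1 - g h) - h^-1 * (1 - e h)|.
have u0 : s * u h @[h --> 0^'+] --> 0.
  rewrite -[X in _ --> X](mulr0 s); apply: cvgM; first exact: cvg_cst.
  have : u h @[h --> 0^'+] --> `|(alpha + beta) - (alpha + beta)|.
    by apply: cvg_norm; apply: (@cvgB _ R^o); [exact: dg|exact: dexp].
  by rewrite subrr normr0.
have hn : s * u (s * n.+1%:R^-1) @[n --> \oo] --> 0.
  have /cvg_at_rightP := u0; apply; split=> [n|].
    by rewrite mulr_gt0 ?invr_gt0 ?ltr0n.
  by rewrite -(mulr0 s); apply: cvgM; [exact: cvg_cst|exact: cvg_harmonic].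
apply/eqP; rewrite -subr_eq0 -normr_le0.
apply: (ler_cvg_to (cvg_cst _) hn); apply: nearW => n.
have n0 : n.+1%:R != 0 :> R by rewrite pnatr_eq0.
pose h := s * n.+1%:R^-1; have h0 : 0 < h by rewrite mulr_gt0 ?invr_gt0 ?ltr0n.
have sE : s = n.+1%:R * h by rewrite /h mulrCA mulfV ?mulr1.
have -> : expR (- ((alpha + beta) * s)) = e h ^+ n.+1.
  by rewrite /e -expRM_natr; congr expR; rewrite sE; ring.
rewrite {1}sE (gX _ (ltW h0)).
have h1 := g_le1 (ltW h0); have h2 := e_le1 _ (ltW h0).
apply: le_trans (norm_subX n.+1 h1 h2) _.
have -> : u (s / n.+1%:R) = h^-1 * `|g h - e h|.
  rewrite -/h /u -mulrBr normrM gtr0_norm ?invr_gt0//; congr (_ * _).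
  by rewrite distrC; congr (`|_|); ring.
by rewrite sE -mulrA mulVKf ?gt_eqF.
Qed.

Lemma two_state_transition s : 0 <= s ->
  p s 0 0 - p s 0 1 = (beta - alpha) / (alpha + beta) +
    2 * alpha / (alpha + beta) * expR (- ((alpha + beta) * s)).
Proof.
move=> s0; have l0 : alpha + beta != 0 by rewrite gt_eqF.
have qs : q s = alpha * (1 - expR (- ((alpha + beta) * s))) / (alpha + beta).
  by rewrite -two_state_eigenvalue// -qE// mulfK.
by rewrite p00// -/(q s) qs; field.
Qed.

End two_state_semigroup.

(** * Moments of the alternating Brownian motion *)

Section alternating.
Context d (T : measurableType d) (R : realType) (P : probability T R).
Variables (alpha beta : R) (X : R -> T -> 'I_2) (B Bs : R -> {RV P >-> R}).
Hypotheses (alpha_gt0 : 0 < alpha) (beta_gt0 : 0 < beta).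
Hypothesis HB : exp_alternating_bm alpha beta X B Bs.

Let jump := eabm_jump HB.
Let BM := eabm_brownian HB.
Let X_meas := mjp_measurable jump.
Let XB := eabm_independent HB.

Let sgn (j : 'I_2) : R := (-1) ^+ (j : nat).

Let mean_sgn (s : R) : R := (beta - alpha) / (alpha + beta) +
    2 * alpha / (alpha + beta) * expR (- ((alpha + beta) * s)).

(** The chain starts at 0, so its law at time s is the row 0 of p s. *)
Lemma jump_law : exists2 p, transition_function (alternating_Q alpha beta) p &
  forall s j, 0 <= s -> P [set w | X s w = j] = (p s 0 j)%:E.
Proof.
have [p tp Markov] := mjp_markov jump; exists p => // s j s0.
have X0 : P [set w | X 0 w = 0] = 1%E by rewrite (mjp_initial jump) mxE.
have mX0 := X_meas 0 (lexx 0).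
rewrite -(measure_setI_full (X_meas j s0) mX0 X0) setIC.
have := Markov 0%N (fun=> 0) (fun=> 0) s j (lexx 0); rewrite subr0.
have -> : \bigcap_(m in `I_1) [set w | X 0 w = 0] = [set w | X 0 w = 0].
  by apply/seteqP; split=> [w /(_ 0%N)|w Xw m _] //; exact.
by move=> -> //; rewrite X0 mul1e.
Qed.

Lemma Rintegral_sgn s : 0 <= s -> \int[P]_w sgn (X s w) = mean_sgn s.
Proof.
move=> s0; have [p tp law] := jump_law.
rewrite /mean_sgn -(two_state_transition _ tp s0) ?addr_gt0//.
have E w : sgn (X s w) = \1_[set w | X s w = 0] w - \1_[set w | X s w = 1] w.
  have mem j : (w \in [set w | X s w = j]) = (X s w == j).
    by apply/idP/eqP; rewrite inE.
  by rewrite !indicE !mem /sgn; case: (X s w) => -[|[|//]] lt2; 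
    rewrite ?subr0 ?sub0r.
have ind j : P.-integrable setT (EFin \o \1_[set w | X s w = j]).
  by apply: integrable_indic => //; exact: X_meas.
under eq_Rintegral do rewrite E.
rewrite RintegralB// /Rintegral !integral_indic//; try exact: X_meas.
by rewrite !setIT; congr (_ - _); exact: (congr1 fine (law s _ s0)).
Qed.

Let sgn_sqr j : sgn j * sgn j = 1.
Proof. by rewrite /sgn -expr2 sqrr_sign. Qed.

Let integrable_sgn s : 0 <= s -> P.-integrable setT (EFin \o (fun w => sgn (X s w))).
Proof.
move=> s0; apply/Lfun1_integrable.
apply: (Lfun_subset12 (fin_num_measure _ _ measurableT)).
apply: integrable_sqr_Lfun2; first exact: measurable_jump_state.
under eq_integral do rewrite expr2 sgn_sqr.
by rewrite integral_cst// mul1e -ge0_fin_numE// fin_num_measure.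
Qed.

Let Lfun2_1 (f : T -> R) : f \in Lfun P 2%:E -> f \in Lfun P 1.
Proof. by apply: Lfun_subset12; exact: fin_num_measure. Qed.

Let Rintegral_P_cst (c : R) : \int[P]__ c = c.
Proof.
rewrite (Rintegral_cst P measurableT) -[RHS]mulr1; congr (_ * _).
exact: (congr1 fine (probability_setT P)).
Qed.

Section fixed_time.
Variable t : R.
Hypothesis t_gt0 : 0 < t.

Let Q := (P \x @lebesgue_measure R)%E.
(** The integrand of the alternating motion, cut off outside [0, t], and the
    integrand 1 of B, cut off likewise: all the moments are inner products of
    these two functions of L^2(T x R). *)
Let Hf (z : T * R) : R := sgn (X z.2 z.1) * \1_(`[0, t]%classic) z.2.
Let Gf (z : T * R) : R := \1_(`[0, t]%classic) z.2.

Let measurable_Hf : measurable_fun setT Hf.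
Proof.
apply: (measurable_right_continuous_process X_meas).
exact: mjp_right_continuous jump.
Qed.

Let Gf_sqr z : Gf z * Gf z = Gf z.
Proof. by rewrite /Gf indicE; case: (_ \in _); rewrite ?mulr1 ?mulr0. Qed.

Let Hf_sqr z : Hf z * Hf z = Gf z.
Proof. by rewrite /Hf mulrACA sgn_sqr mul1r -/(Gf z) Gf_sqr. Qed.

Let Hf_Gf z : Hf z * Gf z = Hf z.
Proof. by rewrite /Hf -mulrA -/(Gf z) Gf_sqr. Qed.

Let Lfun1_itv : (\1_(`[0, t]%classic) : R -> R) \in Lfun (@lebesgue_measure R) 1.
Proof. apply/Lfun1_integrable; exact: integrable_indic_itv. Qed.

Let Gf1 : Gf \in Lfun Q 1.
Proof.
have := @Lfun1_tensor _ _ _ _ R P lebesgue_measure (cst 1) _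
  (Lfun_cst _ _ _) Lfun1_itv.
by under eq_fun do rewrite mul1r.
Qed.

Let Rintegral_Gf : \int[Q]_z Gf z = t.
Proof.
have := @Rintegral_tensor _ _ _ _ R P lebesgue_measure (cst 1) _
  (Lfun_cst _ _ _) Lfun1_itv.
under eq_Rintegral do rewrite mul1r; move=> ->.
have -> : \int[P]_x cst 1 x = 1 :> R.
  by rewrite Rintegral_cst// mul1r; exact: (congr1 fine (probability_setT P)).
rewrite mul1r /Rintegral integral_indic//= setIT.
by rewrite lebesgue_measure_itv/= lte_fin t_gt0 oppr0 addr0.
Qed.

Let Gf_lty : (\int[Q]_z (Gf z)%:E < +oo)%E.
Proof.
have /Lfun1_integrable/integrableP[_ h] := Gf1.
move: h; congr (_ < _)%E; apply: eq_integral => z _ /=; congr EFin.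
by rewrite ger0_norm.
Qed.

Let Gf2 : Gf \in Lfun Q 2%:E.
Proof.
apply: integrable_sqr_Lfun2.
  by have /Lfun1_integrable/integrableP[/measurable_EFinP] := Gf1.
by under eq_integral do rewrite expr2 Gf_sqr.
Qed.

Let Hf2 : Hf \in Lfun Q 2%:E.
Proof.
apply: integrable_sqr_Lfun2; first exact: measurable_Hf.
by under eq_integral do rewrite expr2 Hf_sqr.
Qed.

Let Rintegral_HfHf : \int[Q]_z (Hf z * Hf z) = t.
Proof. by under eq_Rintegral do rewrite Hf_sqr. Qed.

Let Hf1 : Q.-integrable setT (EFin \o Hf).
Proof.
have := integrable_Lfun2M Hf2 Gf2; apply: eq_integrable => // z _ /=.
by rewrite Hf_Gf.
Qed.

Let lambda_gt0 : 0 < alpha + beta. Proof. exact: addr_gt0. Qed.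

Let Rintegral_HfGf : \int[Q]_z (Hf z * Gf z) =
  (beta - alpha) / (alpha + beta) * t +
  2 * alpha / (alpha + beta) ^+ 2 * (1 - expR (- ((alpha + beta) * t))).
Proof.
under eq_Rintegral do rewrite Hf_Gf.
rewrite /Rintegral -(integral21_prod_meas1 Hf1) /fubini_G/=.
transitivity (fine (\int[lebesgue_measure]_(s in `[0%R, t]) (mean_sgn s)%:E)).
  congr fine; rewrite [RHS]integral_mkcond; apply: eq_integral => s _ /=.
  rewrite patchE; have [s0t|s0t] := boolP (s \in `[0, t]%classic).
    have /andP[s0 _] : 0 <= s <= t by move: s0t; rewrite inE /= in_itv.
    rewrite -Rintegral_sgn// /Rintegral fineK.
      apply: eq_integral => w _; rewrite /Hf/= indicE s0t mulr1//.
    by apply: integrable_fin_num => //; exact: integrable_sgn.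
  by rewrite integral0_eq// => w _; rewrite /Hf/= indicE (negbTE s0t) mulr0.
pose F (s : R) : R := (beta - alpha) / (alpha + beta) * s -
  2 * alpha / (alpha + beta) ^+ 2 * expR (- ((alpha + beta) * s)).
have l0 : alpha + beta != 0 by rewrite gt_eqF.
have dF (s : R) : is_derive s 1 F (mean_sgn s).
  apply: is_derive_eq; rewrite /GRing.scale/= /mean_sgn; field.
  exact: l0.
have cmean : continuous mean_sgn.
  move=> s; apply: (@cvgD _ R^o); first exact: cvg_cst.
  apply: cvgM; first exact: cvg_cst.
  apply: (cvg_comp _ expR); last exact: continuous_expR.
  by apply: (@cvgN _ R^o); apply: cvgM; [exact: cvg_cst|exact: cvg_id].
have cF (x : R) : F x @[x --> x] --> F x.
  by apply: differentiable_continuous; apply/derivable1_diffP; case: (dF x).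
rewrite (@continuous_FTC2 _ mean_sgn F)//.
- by rewrite /= /F !mulr0 oppr0 expR0; ring.
- exact: continuous_subspaceT.
- split; first by move=> x _; case: (dF x).
  + exact: cvg_at_right_filter.
  + exact: cvg_at_left_filter.
- by move=> x _; rewrite derive1E; have [_ ->] := dF x.
Qed.

Let B0_ae : ae_eq P setT (B 0) (fun=> 0).
Proof. by have := bm_0 BM; apply: filterS => w ->. Qed.

Let B0_sqr : (\int[P]_w (B 0 w ^+ 2)%:E = 0)%E.
Proof.
rewrite (ae_eq_integral (fun=> 0%E)) ?integral0//.
- by apply/measurable_EFinP; exact: measurable_funX.
- by apply: filterS B0_ae => w /(_ I) -> _; rewrite expr0n.
Qed.

Let B0_Lfun2 : (B 0 : T -> R) \in Lfun P 2%:E.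
Proof. by apply: integrable_sqr_Lfun2 => //; rewrite B0_sqr ltry. Qed.

Let Rintegral_B0 : \int[P]_w B 0 w = 0.
Proof.
rewrite /Rintegral (ae_eq_integral (fun=> 0%E)) ?integral0//.
  exact/measurable_EFinP.
by apply: filterS B0_ae => w /(_ I) -> _.
Qed.

Let cst_adapted u (c : R) : adapted X B u (fun=> c).
Proof. exact: sigma_measurable_cst. Qed.

Let BtE : (B t : T -> R) = fun w => B 0 w + cst 1 w * (B t w - B 0 w).
Proof. by apply/funext => w; rewrite mul1r addrC subrK. Qed.

Let Bt_Lfun2 : (B t : T -> R) \in Lfun P 2%:E.
Proof.
rewrite BtE; apply: Lfun2D => //.
apply: (Lfun2_adapted_mul_increment BM X_meas XB (lexx 0) (ltW t_gt0)).
- exact: cst_adapted.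
- exact: Lfun_cst.
Qed.

Let Rintegral_Bt_sqr : \int[P]_w (B t w * B t w) = t.
Proof.
rewrite BtE (ito_step BM X_meas XB (lexx 0) (ltW t_gt0)) ?Lfun_cst//.
- have -> : \int[P]_w (B 0 w * B 0 w) = 0 by rewrite -[RHS]/(fine 0) -B0_sqr.
  by under eq_Rintegral do rewrite mulr1; rewrite Rintegral_P_cst subr0 mulr1 add0r.
- exact: adapted_brownian.
- exact: adapted_brownian.
- exact: cst_adapted.
- exact: cst_adapted.
Qed.

Let Rintegral_Bt : \int[P]_w B t w = 0.
Proof.
have [/Lfun2_1 i1 i0 _] := increment_moments BM (lexx 0) (ltW t_gt0).
have <- : \int[P]_w (B 0 w + (B t w - B 0 w)) = \int[P]_w B t w.
  by apply: eq_Rintegral => w _; rewrite addrC subrK.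
rewrite RintegralD//; first by rewrite Rintegral_B0 i0 addr0.
- by apply/Lfun1_integrable/Lfun2_1.
- exact/Lfun1_integrable.
Qed.

Lemma brownian_moments : [/\ (B t : T -> R) \in Lfun P 2%:E,
  \int[P]_w B t w = 0 & \int[P]_w (B t w * B t w) = t].
Proof. by split; [exact: Bt_Lfun2|exact: Rintegral_Bt|exact: Rintegral_Bt_sqr]. Qed.

Section simple.
Variable S : simple_process (joint_filtration X B) t.
Let v := sp_val S.
Let s := sp_time S.
Let N := sp_size S.
Let s_le : forall m, (m < N)%N -> s m <= s m.+1 := @sp_time_le _ _ _ _ S.
Let s0 : s 0%N = 0 := sp_time0 S.
Let sN : s N = t := sp_timeN S.
Let s_pos : 0 <= s 0%N. Proof. by rewrite s0. Qed.

Let v_sqint : square_integrable_integrand X B N s v.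
Proof.
move=> m mN; have Fv : adapted X B (s m) (v m) by move=> A mA; exact: sp_adapted.
split=> //; apply: integrable_sqr_Lfun2; first exact: (adapted_measurable X_meas Fv).
have [M vM] := sp_bounded S.
apply: (@le_lt_trans _ _ (\int[P]_w (M ^+ 2)%:E)%E).
  apply: ge0_le_integral => //.
  - by move=> w _; rewrite lee_fin sqr_ge0.
  - apply/measurable_EFinP; apply: measurable_funX.
    exact: (adapted_measurable X_meas Fv).
  - move=> w _; rewrite lee_fin -[leLHS]real_normK ?num_real//.
    by rewrite ler_sqr ?nnegrE//; [exact: vM|exact: le_trans (vM m w mN)].
by rewrite integral_cst// ltey_eq fin_numM// fin_num_measure.
Qed.

Let Iv := simple_ito S B.

Let IvE : Iv = ito_sum B s (fun=> 0) v N.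
Proof. by apply/funext => w; rewrite /ito_sum add0r. Qed.

Let one_sqint : square_integrable_integrand X B N s (fun _ _ => 1).
Proof. by move=> m mN; split; [exact: cst_adapted|exact: Lfun_cst]. Qed.

Let zero_sqint : square_integrable_integrand X B N s (fun _ _ => 0).
Proof. by move=> m mN; split; [exact: cst_adapted|exact: Lfun_cst]. Qed.

Let BtE' : (B t : T -> R) = ito_sum B s (B 0) (fun _ _ => 1) N.
Proof.
apply/funext => w; rewrite /ito_sum; under eq_bigr do rewrite mul1r.
rewrite -(big_mkord xpredT (fun m => B (s m.+1) w - B (s m) w)) telescope_sumr//.
by rewrite s0 sN addrC subrK.
Qed.

Lemma simple_ito_Lfun2 : Iv \in Lfun P 2%:E.
Proof.
rewrite IvE; apply: (ito_sum_Lfun2 BM X_meas XB s_pos s_le (leqnn N) _ _ v_sqint).2.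
- exact: cst_adapted.
- exact: Lfun_cst.
Qed.

(** The factor 1 presents the mean as an inner product, so that both the isometry
    and the continuity of the inner product apply to it. *)
Lemma Rintegral_simple_ito : \int[P]_w (Iv w * 1) = 0.
Proof.
have -> : \int[P]_w (Iv w * 1) =
  \int[P]_w (ito_sum B s (fun=> 0) v N w * ito_sum B s (fun=> 1) (fun _ _ => 0) N w).
  apply: eq_Rintegral => w _; rewrite -IvE; congr (_ * _).
  by rewrite /ito_sum big1 ?addr0// => m _; rewrite mul0r.
rewrite (ito_isometry BM X_meas XB s_pos s_le) ?Lfun_cst//; try exact: cst_adapted.
rewrite mul0r Rintegral_P_cst add0r big1// => m _.
by under eq_Rintegral do rewrite mulr0; rewrite Rintegral_P_cst mulr0.
Qed.

Let fS (z : T * R) := simple_process_eval S z.2 z.1.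

Let fS_Gf z : fS z * Gf z = fS z.
Proof.
rewrite /fS /Gf /simple_process_eval mulr_suml; apply: eq_bigr => m _.
rewrite -mulrA; congr (_ * _); rewrite !indicE.
have [z_in|] := boolP (z.2 \in _); last by rewrite mul0r.
rewrite mul1r; congr (_%:R); apply/eqP; rewrite eqb1 inE/= in_itv/=.
move: z_in; rewrite inE/= in_itv/= => /andP[lo hi].
apply/andP; split.
  apply: ltW; apply: le_lt_trans lo; rewrite -s0.
  by apply: (times_le s_le) => //; exact: ltnW.
by rewrite (le_trans hi)// (le_trans (times_le s_le (ltn_ord m) (leqnn N)))// sN.
Qed.

Lemma simple_process_Lfun2 : fS \in Lfun Q 2%:E.
Proof. by apply: (Lfun2_step_process s_le) => m mN; have [] := v_sqint mN. Qed.

Lemma Rintegral_simple_process_itv :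
  \int[Q]_z (fS z * Gf z) = \int[P]_w (Iv w * B t w).
Proof.
under eq_Rintegral do rewrite fS_Gf.
rewrite IvE BtE' (ito_isometry BM X_meas XB s_pos s_le) ?Lfun_cst//.
- under [in RHS]eq_Rintegral do rewrite mul0r; rewrite Rintegral_P_cst add0r.
  have v1 m : (m < N)%N -> v m \in Lfun P 1.
    by move=> mN; apply: Lfun2_1; have [] := v_sqint mN.
  have [_ ->] := Rintegral_step_process s_le v1.
  by apply: eq_bigr => m _; under [in RHS]eq_Rintegral do rewrite mulr1.
- by rewrite s0; exact: adapted_brownian.
Qed.

Lemma Rintegral_simple_process_sqr :
  \int[Q]_z (fS z * fS z) = \int[P]_w (Iv w * Iv w).
Proof.
rewrite IvE (ito_isometry BM X_meas XB s_pos s_le) ?Lfun_cst//;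
  try exact: cst_adapted.
under [in RHS]eq_Rintegral do rewrite mul0r; rewrite Rintegral_P_cst add0r.
by rewrite (Rintegral_step_processM s_le) => // m mN; have [] := v_sqint mN.
Qed.

(** The squared distance in the definition of the Ito integral is a distance in
    L^2(T x R): both integrands vanish at times outside [0, t]. *)
Lemma iterated_simple_process_dist :
  (\int[P]_w \int[lebesgue_measure]_(r in `[0%R, t])
     ((simple_process_eval S r w - (-1) ^+ (X r w : nat)) ^+ 2)%:E =
   \int[Q]_z ((fS z - Hf z) ^+ 2)%:E)%E.
Proof.
have mfS : measurable_fun setT fS.
  by have := simple_process_Lfun2; rewrite inE => /andP[+ _]; rewrite inE.
have mh : measurable_fun setT (fun z => ((fS z - Hf z) ^+ 2)%:E).
  by apply/measurable_EFinP; apply: measurable_funX; exact: measurable_funB.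
have h0 z : (0 <= ((fS z - Hf z) ^+ 2)%:E)%E by rewrite lee_fin sqr_ge0.
have -> := @fubini_tonelli1 _ _ _ _ R P lebesgue_measure _ mh h0.
apply: eq_integral => w _; rewrite integral_mkcond; apply: eq_integral => r _ /=.
rewrite patchE; have [r0t|r0t] := boolP (r \in `[0, t]%classic).
  by rewrite /Hf/= indicE r0t mulr1.
have G0 : Gf (w, r) = 0 by rewrite /Gf indicE (negbTE r0t).
by rewrite -fS_Gf -Hf_Gf G0 !mulr0 subrr expr0n.
Qed.

End simple.

(** The simple integrals I n that define the alternating motion.  By the isometry
    their inner products with B t and with themselves are those of the simple
    integrands with the two cut-off integrands, and converge with them. *)
Let limits : exists2 I : nat -> T -> R,
  (forall n, I n \in Lfun P 2%:E /\ \int[P]_w (I n w * 1) = 0) &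
  [/\ (\int[P]_w ((I n w - Bs t w) ^+ 2)%:E)%E @[n --> \oo] --> 0%E,
    \int[P]_w (I n w * B t w) @[n --> \oo] --> \int[Q]_z (Hf z * Gf z) &
    \int[P]_w (I n w * I n w) @[n --> \oo] --> t].
Proof.
have [S [cvS cvI]] := eabm_integral HB (ltW t_gt0).
pose fS n (z : T * R) := simple_process_eval (S n) z.2 z.1.
have fS2 n : fS n \in Lfun Q 2%:E by exact: simple_process_Lfun2.
have cfS : (\int[Q]_z ((fS n z - Hf z) ^+ 2)%:E)%E @[n --> \oo] --> 0%E.
  by under eq_fun do rewrite -iterated_simple_process_dist.
have cG : (\int[Q]_z ((Gf z - Gf z) ^+ 2)%:E)%E @[n --> \oo] --> 0%E.
  apply: cvg_near_cst; apply: nearW => _; apply: integral0_eq => z _.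
  by rewrite subrr expr0n.
exists (fun n => simple_ito (S n) B).
  by move=> n; split; [exact: simple_ito_Lfun2|exact: Rintegral_simple_ito].
split=> //.
- under eq_fun do rewrite -Rintegral_simple_process_itv.
  exact: (cvg_Rintegral_Lfun2M fS2 (fun=> Gf2) Hf2 Gf2 cfS cG).
- rewrite -[X in _ --> X]Rintegral_HfHf.
  under eq_fun do rewrite -Rintegral_simple_process_sqr.
  exact: (cvg_Rintegral_Lfun2M fS2 fS2 Hf2 Hf2 cfS cfS).
Qed.

Lemma alternating_moments : [/\ (Bs t : T -> R) \in Lfun P 2%:E,
  \int[P]_w Bs t w = 0, \int[P]_w (Bs t w * Bs t w) = t &
  \int[P]_w (Bs t w * B t w) =
    (beta - alpha) / (alpha + beta) * t +
    2 * alpha / (alpha + beta) ^+ 2 * (1 - expR (- ((alpha + beta) * t)))].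
Proof.
rewrite -Rintegral_HfGf.
have [I I2 [cI cIB cII]] := limits.
have I_L2 n : I n \in Lfun P 2%:E by have [] := I2 n.
have Bs2 : (Bs t : T -> R) \in Lfun P 2%:E.
  have [n In] : exists n, (\int[P]_w ((I n w - Bs t w) ^+ 2)%:E < +oo)%E.
    have /fine_cvgP[/filter_ex[n fin_n] _] := cI; exists n.
    by rewrite ltey_eq fin_n.
  have dn : (fun w => I n w - Bs t w) \in Lfun P 2%:E.
    apply: integrable_sqr_Lfun2 => //; apply: measurable_funB => //.
    by have := I_L2 n; rewrite inE => /andP[+ _]; rewrite inE.
  rewrite (_ : (Bs t : T -> R) = fun w => I n w - (I n w - Bs t w)).
    exact: Lfun2B.
  by apply/funext => w; rewrite subKr.
have cst_cvg (f : T -> R) : (\int[P]_w ((f w - f w) ^+ 2)%:E)%E @[_ --> \oo] --> 0%E.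
  apply: cvg_near_cst; apply: nearW => _; apply: integral0_eq => w _.
  by rewrite subrr expr0n.
have one2 : (fun=> 1 : R) \in Lfun P 2%:E by exact: Lfun_cst.
split=> //.
- have c := cvg_Rintegral_Lfun2M I_L2 (fun=> one2) Bs2 one2 cI (cst_cvg _).
  have <- : \int[P]_w (Bs t w * 1) = \int[P]_w Bs t w.
    by apply: eq_Rintegral => w _; rewrite mulr1.
  apply: (cvg_unique _ c) => //; apply: cvg_near_cst; apply: nearW => n.
  by have [] := I2 n.
- have c := cvg_Rintegral_Lfun2M I_L2 I_L2 Bs2 Bs2 cI cI.
  exact: (cvg_unique _ c).
- have c := cvg_Rintegral_Lfun2M I_L2 (fun=> Bt_Lfun2) Bs2 Bt_Lfun2 cI (cst_cvg _).
  exact: (cvg_unique _ c).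
Qed.

End fixed_time.
End alternating.

(** * The correlation coefficient *)

Theorem theorem3p3 (d : measure_display) (T : measurableType d)
    (R : realType) (P : probability T R) (alpha beta : R)
    (X : R -> T -> 'I_2) (B Bs : R -> {RV P >-> R})
    (alpha_gt0 : 0 < alpha) (beta_gt0 : 0 < beta)
    (HB : exp_alternating_bm alpha beta X B Bs) (t : R) (t_gt0 : 0 < t) :
  (corr P (B t) (Bs t))%:E = ('E_P[(B t : T -> R) \* (Bs t : T -> R)] * (t^-1)%:E)%E /\
  corr P (B t) (Bs t) =
    (alpha^-1 - beta^-1) / (alpha^-1 + beta^-1) +
    2 * alpha * (1 - expR (- (t * (alpha + beta)))) /
      (t * (alpha + beta) ^+ 2).
Proof.
have [B2 EB VB] := brownian_moments HB t_gt0.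
have [Bs2 EBs VBs EBBs] := alternating_moments alpha_gt0 beta_gt0 HB t_gt0.
have fineE (f : T -> R) : fine ('E_P[f])%E = \int[P]_w f w by rewrite unlock.
have var (f : T -> R) : f \in Lfun P 2%:E -> \int[P]_w f w = 0 ->
    \int[P]_w (f w * f w) = t -> fine ('V_P[f])%E = t.
  move=> f2 f0 ff; have Ef : ('E_P[f] = 0)%E.
    rewrite -[LHS]fineK ?fineE ?f0// expectation_fin_num//.
    by apply: Lfun_subset12 f2; exact: fin_num_measure.
  by rewrite varianceE// Ef expe2 mule0 sube0 fineE.
have t0 : t != 0 by rewrite gt_eqF.
have corrE : corr P (B t) (Bs t) = \int[P]_w (Bs t w * B t w) / t.
  rewrite /corr !fineE EB mul0r subr0 (var _ B2 EB VB) (var _ Bs2 EBs VBs).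
  rewrite -expr2 sqr_sqrtr ?ltW//; congr (_ / _).
  by apply: eq_Rintegral => w _; rewrite mulrC.
split.
  rewrite corrE EFinM; congr (_ * _)%E.
  rewrite -[RHS]fineK ?fineE; last first.
    by apply: expectation_fin_num; exact: Lfun2_mul_Lfun1.
  by congr EFin; apply: eq_Rintegral => w _; rewrite mulrC.
rewrite corrE EBBs [in RHS](mulrC t).
have a0 : alpha != 0 by rewrite gt_eqF.
have b0 : beta != 0 by rewrite gt_eqF.
have l0 : alpha + beta != 0 by rewrite gt_eqF// addr_gt0.
field.
by rewrite t0 a0 l0 b0.
Qed.
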